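(* There exists a family of positive finite constants $(C(d_1,d_2))_{d_1\ge 1,\,d_2\ge 0}$ such that for every $d\ge 2$ and every $z\in\mathbb{R}^d\setminus\{0\}$, \[ \mu_\epsilon(z)=\|z\|_1-C\big(d_1(z),d_2(z)\big)\,\gamma(z)\,\epsilon^{1/d_1(z)}+o\big(\epsilon^{1/d_1(z)}\big)\quad\text{as }\epsilon\to 0 . \]
   Context: Bernoulli site first-passage percolation on $\mathbb{Z}^d$, $d\ge 2$, $\epsilon\in[0,1]$: $(\tau_\epsilon(x))_{x\in\mathbb{Z}^d}$ are i.i.d. with $\mathbb{P}(\tau_\epsilon(x)=1)=1-\epsilon$ and $\mathbb{P}(\tau_\epsilon(x)=0)=\epsilon$; a site $x$ is open if $\tau_\epsilon(x)=0$. Two vertices are neighbours if their Euclidean distance is $1$; a path is a finite sequence $\pi=(x_0,\dots,x_n)$ of successive neighbours. Its travel time is $\tau_\epsilon(\pi)=\sum_{i=0}^{n-1}\tau_\epsilon(x_i)$ (the last vertex is not counted), and $T_\epsilon(x,y)=\inf_{\pi:x\to y}\tau_\epsilon(\pi)$. For $z\in\mathbb{R}^d$, $\lfloor z\rfloor$ is the coordinatewise integer part, and the time constant is $\mu_\epsilon(z)=\lim_{n\to\infty}\frac1n\mathbb{E}[T_\epsilon(0,\lfloor nz\rfloor)]$ (this limit exists). For $z=(z_1,\dots,z_d)$: $d_1(z)=\#\{i:z_i\neq 0\}$, $d_2(z)=d-d_1(z)$, and $\gamma(z)=\prod_{i:z_i\neq0}|z_i|^{1/d_1(z)}$ (geometric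 mean of the absolute values of the nonzero coordinates). $\|\cdot\|_1$ is the $\ell^1$ norm. *)

(* Defs.v *)
From HB Require Import structures.
From mathcomp Require Import all_boot all_order all_algebra.
From mathcomp Require Import all_classical all_reals all_analysis.
Set Implicit Arguments. Unset Strict Implicit. Unset Printing Implicit Defensive.
Import Order.TTheory GRing.Theory Num.Theory.
Import numFieldNormedType.Exports.
Local Open Scope classical_set_scope.
Local Open Scope ring_scope.

Definition site (d : nat) := {ffun 'I_d -> int}.

Definition neighbor (d : nat) : rel (site d) :=
  fun x y => (\sum_(i < d) (x i - y i) ^+ 2 == 1)%R.

Section FPP.
Variables (R : realType) (d : nat).

(* A path is x :: s with successive neighbours, starting at x and ending at
   [last x s].  Its travel time sums the weights of all vertices but the last. *)
Definition travel_time (tau : site d -> R) (x : site d) (s : seq (site d)) : R :=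
  \sum_(v <- belast x s) tau v.

Definition paths_from_to (x y : site d) : set (seq (site d)) :=
  [set s | path (@neighbor d) x s /\ last x s = y].

Definition passage_time (tau : site d -> R) (x y : site d) : \bar R :=
  ereal_inf [set (travel_time tau x s)%:E | s in paths_from_to x y].

Definition origin : site d := [ffun => 0%R].

Definition floor_site (z : 'I_d -> R) : site d := [ffun i => Num.floor (z i)].

Context {dT : measure_display} {Omega : measurableType dT}.

Definition mutually_independent {I : eqType} (P : probability Omega R)
    (X : I -> Omega -> R) : Prop :=
  forall (s : seq I), uniq s ->
  forall B : I -> set R, (forall i, measurable (B i)) ->
  P (\big[setI/setT]_(i <- s) (X i @^-1` B i)) =
    (\prod_(i <- s) P (X i @^-1` B i))%E.

Definition bernoulli_site_field (P : probability Omega R) (eps : R)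
    (tau : site d -> Omega -> R) : Prop :=
  (forall x, measurable_fun setT (tau x)) /\
  (forall x, P (tau x @^-1` [set 1]) = (1 - eps)%:E) /\
  (forall x, P (tau x @^-1` [set 0]) = eps%:E) /\
  mutually_independent P tau.

Definition expected_passage_time (P : probability Omega R)
    (tau : site d -> Omega -> R) (y : site d) : \bar R :=
  (\int[P]_w passage_time (fun v => tau v w) origin y)%E.

Definition time_constant (P : probability Omega R)
    (tau : site d -> Omega -> R) (z : 'I_d -> R) : R :=
  limn (fun n : nat =>
    fine (expected_passage_time P tau (floor_site (fun i => n%:R * z i))) / n%:R).

End FPP.

Definition nonzero_coords (d : nat) {R : realType} (z : 'I_d -> R) : {set 'I_d} :=
  [set i | z i != 0].

Definition d1 (d : nat) {R : realType} (z : 'I_d -> R) : nat := #|nonzero_coords z|.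
Definition d2 (d : nat) {R : realType} (z : 'I_d -> R) : nat := (d - d1 z)%N.

Definition gamma (d : nat) {R : realType} (z : 'I_d -> R) : R :=
  \prod_(i in nonzero_coords z) (`|z i| `^ (d1 z)%:R^-1).

Definition norm1 (d : nat) {R : realType} (z : 'I_d -> R) : R :=
  \sum_(i < d) `|z i|.

(* Main.v *)
Require Import Defs.
From HB Require Import structures.
From mathcomp Require Import all_boot all_order all_algebra.
From mathcomp Require Import all_classical all_reals all_analysis.
From mathcomp Require Import measurable_realfun.
From mathcomp Require Import zify ring lra.
Set Implicit Arguments. Unset Strict Implicit. Unset Printing Implicit Defensive.
Import Order.TTheory GRing.Theory Num.Theory.
Import numFieldNormedType.Exports.
Local Open Scope classical_set_scope.
Local Open Scope ring_scope.

(** A monotone path from 0 to nz has length n|z|_1, so |z|_1 - mu is the best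
    rate of (open sites visited) - (steps wasted). Let I be the support of z and
    a = #|I|.

    Lower bound by coarse-graining: group the sites into boxes of sides k_i
    (i in I) and call a box open if it contains an open site; this is again a
    Bernoulli field, of parameter 1 - (1 - eps)^M with M the number of sites of
    a box. A chain of open boxes that is strictly increasing in the directions
    of I lifts to a chain of open sites. Hence the gain at parameter eps towards
    kz dominates the strict-chain gain at parameter delta ~ M eps towards z.

    Upper bound by a first moment: an exponentially tilted sum over all chains
    of open sites shows that the gain is O(eps^(1/a)), and that restricting an
    optimal chain to its strict records costs only o(eps^(1/a)).

    With g z eps the gain divided by eps^(1/a) and by the geometric mean of z,
    these two facts give limsup_(delta -> 0) g w delta <= liminf_(eps -> 0) g z eps
    for any z and w of support I. So g z has a limit, the same for all z; no
    Poisson limit model is needed to identify it. *)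

(** * Passage times and chains of open sites *)

Section Paths.
Variable d : nat.
Implicit Types (x y z : site d) (s q : seq (site d)) (A B : pred (site d)).

(** The obstacle is strictness. If successive open boxes increase strictly in every direction of I,
    any choice of open sites in them still increases; if two boxes share a coordinate in I, the lift
    may step backwards. Optimal chains need not be strict, so the price of strictness must be small
    against eps^(1/a). It is at most twice the number of stalls (a step failing to increase in a
    coordinate of I), and the tilted sum controls stalls by giving each a bonus exp(2 theta): the
    loss relative to eps^(1/a) is of order 1/theta, and theta can be taken as large as desired once
    the parameter is small. Off I the boxes have side 1, so lifting keeps the sideways moves and
    rescales only the drift. The scaling in the theorem comes from counting sites. With k_i ~ lam
    z_i / w_i, the relation M eps ~ delta forces lam ~ (delta / eps)^(1/a) (gmean w / gmean z), and
    the bound of the gain at delta towards w by lam times the gain at eps towards z becomes, after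
    division, the comparison of the two values of g. *)

Definition l1 x y : nat := (\sum_i absz (x i - y i)%R)%N.

Lemma l1xx x : l1 x x = 0%N.
Proof. by rewrite /l1 big1 // => i _; rewrite subrr. Qed.

Lemma l1C x y : l1 x y = l1 y x.
Proof. by apply: eq_bigr => i _; rewrite -abszN opprB. Qed.

Lemma l1_triangle y x z : (l1 x z <= l1 x y + l1 y z)%N.
Proof. by rewrite /l1 -big_split /=; apply: leq_sum => i _; lia. Qed.

Lemma l1_eq0 x y : l1 x y = 0%N -> x = y.
Proof.
move=> h; apply/ffunP => i; move/eqP: h.
rewrite /l1 sum_nat_eq0 => /forallP/(_ i) /=; lia.
Qed.

Lemma neighbor_l1 x y : neighbor x y -> (l1 x y <= 1)%N.
Proof.
rewrite /neighbor => /eqP h.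
suff : ((l1 x y)%:Z <= \sum_(i < d) (x i - y i) ^+ 2)%R by rewrite h.
rewrite -natz /l1 natr_sum.
by apply: ler_sum => i _; rewrite natz; nia.
Qed.

(** [A] is the set of open sites. Only the vertices of [belast x s] are charged, as in the travel
    time. *)
Definition walk_within A x y (n : nat) : Prop :=
  exists s, [/\ path (@neighbor d) x s, last x s = y &
                (count (predC A) (belast x s) <= n)%N].

Lemma toward x y : x != y ->
  exists2 x', neighbor x x' & l1 x y = (l1 x' y).+1.
Proof.
move=> nxy; have [i ni] : exists i, x i != y i.
  apply/existsP; apply: contraNT nxy; rewrite negb_exists => /forallP h.
  by apply/eqP/ffunP => i; apply/eqP; move: (h i); rewrite negbK.
pose c : int := if (x i < y i)%R then 1 else -1.
exists [ffun j => if j == i then (x i + c)%R else x j].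
  rewrite /neighbor (bigD1 i) //= big1 => [|j /negbTE ji]; rewrite !ffunE ?eqxx.
    by rewrite /c; case: ifP => _; apply/eqP; ring.
  by rewrite ji; ring.
rewrite /l1 (bigD1 i) //= [in RHS](bigD1 i) //= !ffunE eqxx.
rewrite [in RHS](eq_bigr (fun j => absz (x j - y j)%R)) => [|j /negbTE ji].
  by rewrite -addSn; congr (_ + _)%N; move: ni; rewrite /c; case: ifP; lia.
by rewrite !ffunE ji.
Qed.

Lemma geodesic x y : exists s,
  [/\ path (@neighbor d) x s, last x s = y & size s = l1 x y].
Proof.
have [n] := ubnP (l1 x y); elim: n x => // n IH x hn.
have [->|nxy] := eqVneq x y; first by exists [::]; rewrite l1xx.
have [x' nx e] := toward nxy.
have [|s [ps ls ss]] := IH x'; first by move: hn; rewrite e; lia.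
by exists (x' :: s); rewrite /= nx ps ls ss e.
Qed.

Lemma walk_within_l1 A x y : walk_within A x y (l1 x y).
Proof.
have [s [ps ls ss]] := geodesic x y; exists s; split => //.
by rewrite -ss -(size_belast x s) count_size.
Qed.

Lemma walk_within_ex A x y : exists n, `[< walk_within A x y n >].
Proof. by exists (l1 x y); apply/asboolP/walk_within_l1. Qed.

Definition ptime A x y : nat := ex_minn (walk_within_ex A x y).

Lemma ptime_le A x y n : walk_within A x y n -> (ptime A x y <= n)%N.
Proof. by move=> h; rewrite /ptime; case: ex_minnP => m _; apply; apply/asboolP. Qed.

Lemma ptimeP A x y : walk_within A x y (ptime A x y).
Proof. by rewrite /ptime; case: ex_minnP => m /asboolP. Qed.

Lemma ptime_le_l1 A x y : (ptime A x y <= l1 x y)%N.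
Proof. exact/ptime_le/walk_within_l1. Qed.

Lemma ptime_triangle A y x z : (ptime A x z <= ptime A x y + ptime A y z)%N.
Proof.
have [s [ps ls cs]] := ptimeP A x y; have [t [pt lt ct]] := ptimeP A y z.
apply: ptime_le; exists (s ++ t); split.
- by rewrite cat_path ps ls.
- by rewrite last_cat ls.
- by rewrite belast_cat count_cat ls leq_add.
Qed.

(** The starting vertex is the one charged for the first step, so leaving an open site along a
    geodesic saves that step. *)
Lemma ptime_open A x y : A x -> x != y -> (ptime A x y < l1 x y)%N.
Proof.
move=> Ax nxy; have [s [ps ls ss]] := geodesic x y.
have l0 : (0 < l1 x y)%N by rewrite lt0n; apply: contra nxy => /eqP/l1_eq0 ->.
case: s ps ls ss => [|u s] /= ps ls ss; first by rewrite -ss in l0.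
rewrite -ss ltnS; apply: ptime_le; exists (u :: s); split => //=.
by rewrite Ax /= add0n -(size_belast u s) count_size.
Qed.

Lemma ptime_mono A B x y : subpred A B -> (ptime B x y <= ptime A x y)%N.
Proof.
move=> AB; have [s [ps ls cs]] := ptimeP A x y; apply: ptime_le; exists s; split => //.
by apply: leq_trans cs; apply: sub_count => v /=; apply/contra/AB.
Qed.

Lemma ptime_map A B (f : site d -> site d) x y :
  (forall u v, neighbor u v -> neighbor (f u) (f v)) ->
  (forall u, A u -> B (f u)) -> (ptime B (f x) (f y) <= ptime A x y)%N.
Proof.
move=> fn AB; have [s [ps ls cs]] := ptimeP A x y; apply: ptime_le.
exists (map f s); split.
- by rewrite path_map; apply: sub_path ps => u v /=; apply: fn.
- by rewrite last_map ls.
- rewrite belast_map count_map; apply: leq_trans cs.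
  by apply: sub_count => v /=; apply/contra/AB.
Qed.

Fixpoint chlen x q y : nat :=
  if q is a :: q' then (l1 x a + chlen a q' y)%N else l1 x y.

Lemma chlen_triangle b x q y : (chlen x q y <= l1 x b + chlen b q y)%N.
Proof.
case: q => [|a q] /=; first exact: l1_triangle.
by rewrite addnA leq_add2r l1_triangle.
Qed.

Lemma chlen_filter A x s : path (@neighbor d) x s ->
  (chlen x [seq v <- belast x s | A v] (last x s) <= size s)%N.
Proof.
elim: s x => [|b s IH] x /=; first by rewrite l1xx.
case/andP => /neighbor_l1 nb /IH {}IH.
have h := chlen_triangle b x [seq v <- belast b s | A v] (last b s).
by case: ifP => _ /=; rewrite ?l1xx; lia.
Qed.

(** Erase the loops of an optimal walk and keep its open sites in order of visit: every step of the
    walk starts at an open site or at a charged one, and the chain is no longer than the walk.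
    Distinctness of the sites later gives the probability [e ^+ size q]. *)
Lemma open_chain A x y : exists q,
  [/\ uniq q, all A q & (chlen x q y <= size q + ptime A x y)%N].
Proof.
have [s [ps ls cs]] := ptimeP A x y.
have [p' [pp' up' sub lp']] : exists p', [/\ path (@neighbor d) x p',
    uniq (x :: p'), {subset p' <= s} & last x p' = last x s].
  by case: (shortenP ps) => p' *; exists p'.
have ub : uniq (belast x p').
  by move: up'; rewrite lastI rcons_uniq => /andP[].
exists [seq v <- belast x p' | A v]; split; first exact: filter_uniq.
  exact: filter_all.
have := chlen_filter A pp'; rewrite lp' ls => /leq_trans; apply.
rewrite -(size_belast x p') -(count_predC A (belast x p')) size_filter leq_add2l.
apply: leq_trans cs; rewrite -!size_filter.
apply: uniq_leq_size; first exact: filter_uniq.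
move=> v; rewrite !mem_filter => /andP[-> vb] /=.
(* A loop-free walk meets its endpoint only at the end, so [v] is also a charged vertex of the
   original walk. *)
have vy : v != last x p'.
  by move: up'; rewrite lastI rcons_uniq => /andP[+ _]; apply: contraNneq => <-.
have : v \in x :: p' by rewrite lastI mem_rcons inE vb orbT.
rewrite inE => vs; have : v \in x :: s.
  by rewrite inE; case/orP: vs => [->//|/sub ->]; rewrite orbT.
by rewrite lastI mem_rcons inE -lp' (negbTE vy).
Qed.

End Paths.

(** * Strict records *)

Section Records.
Implicit Types (s : seq int) (u v Y M : int).

(* A step u <= 0 is a non-record, and the next |u| increasing steps may be too. *)
Definition backlog u : nat := if (u <= 0)%R then (absz u).+1 else 0%N.

Fixpoint backlogs v s Y : nat :=
  if s is a :: s' then (backlog (a - v)%R + backlogs a s' Y)%N else backlog (Y - v)%R.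

Fixpoint nonrecords M s : nat :=
  if s is a :: s' then ((a <= M)%R + nonrecords (Num.max M a) s')%N else 0%N.

(** [M] is the running maximum and [v] the current position: the gap [M - v] bounds the number of
    increasing steps that may still fail to be records. *)
Lemma nonrecords_le v M s Y : (v <= M)%R ->
  (nonrecords M s <= backlogs v s Y + absz (M - v)%R)%N.
Proof.
elim: s v M => // a s IH v M vM /=.
have := IH a (Num.max M a); rewrite le_max lexx orbT => /(_ isT).
rewrite /backlog maxEle; case: ifP; case: ifP; lia.
Qed.

(** From [Y] or above the chain must come back down to [Y], and each increasing step made there
    lengthens the descent by at least one. The second summand is the debt of the current
    position. *)
Lemma count_ge_le v s Y :
  (count (fun a => Y <= a)%R s + (if Y <= v then (absz (v - Y)).+1 else 0)%R
     <= backlogs v s Y)%N.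
Proof.
elim: s v => [|a s IH] v /=; first by rewrite /backlog; do !case: ifP; lia.
have {IH} := IH a; rewrite /backlog; move: (count _ s) (backlogs a s Y) => m n.
by case: (leP Y a); case: (leP Y v); case: (leP (a - v) 0) => /=; lia.
Qed.

End Records.

Section StrictChains.
Variables (d : nat) (I : {set 'I_d}).
Implicit Types (x y u v w : site d) (q s : seq (site d)) (A : pred (site d)).

Definition slt x y := [forall i in I, (x i < y i)%R].
Definition sle x y := [forall i in I, (x i <= y i)%R].

Lemma slt_sle x y : slt x y -> sle x y.
Proof. by move=> /forall_inP h; apply/forall_inP => i /h /ltW. Qed.

Lemma sle_slt_trans x y z : sle x y -> slt y z -> slt x z.
Proof.
move=> /forall_inP h /forall_inP k; apply/forall_inP => i iI.
exact: le_lt_trans (h i iI) (k i iI).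
Qed.

Definition lside x y : nat := (\sum_(i in ~: I) absz (x i - y i)%R)%N.

Fixpoint side x q y : nat :=
  if q is a :: q' then (lside x a + side a q' y)%N else lside x y.

Definition drift x y : int := \sum_(i in I) (y i - x i).

Definition ldesc x y : nat :=
  (\sum_(i in I) (if y i - x i <= 0 then absz (y i - x i) else 0)%R)%N.

Fixpoint desc x q y : nat :=
  if q is a :: q' then (ldesc x a + desc a q' y)%N else ldesc x y.

Definition lstall x y : nat := (\sum_(i in I) (y i - x i <= 0)%R)%N.

Fixpoint stalls x q y : nat :=
  if q is a :: q' then (lstall x a + stalls a q' y)%N else lstall x y.

Lemma drift_add y x z : drift x y + drift y z = drift x z.
Proof. by rewrite /drift -big_split /=; apply: eq_bigr => i _; ring. Qed.

(** In each coordinate of [I], |t| is t plus twice the negative part of t. Since the drift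
    telescopes, a chain is longer than its drift by twice its descent plus its sideways length. *)
Lemma l1_decomp x y : (l1 x y)%:Z = drift x y + 2 * (ldesc x y)%:Z + (lside x y)%:Z.
Proof.
rewrite /l1 /drift /ldesc /lside -!natz !natr_sum mulr_sumr -big_split /=.
rewrite (bigID (mem I)) /=; congr (_ + _).
  by apply: eq_bigr => i _; rewrite !natz; case: ifP; lia.
by apply: eq_bigl => i; rewrite inE.
Qed.

Lemma chlen_decomp x q y :
  (chlen x q y)%:Z = drift x y + 2 * (desc x q y)%:Z + (side x q y)%:Z.
Proof.
elim: q x => [|a q IH] x /=; first exact: l1_decomp.
by rewrite !PoszD IH l1_decomp -(drift_add a x y); ring.
Qed.

Lemma desc_monotone x q y : path sle x (rcons q y) -> desc x q y = 0%N.
Proof.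
have h u v : sle u v -> ldesc u v = 0%N.
  by move=> /forall_inP k; apply: big1 => i /k ?; case: ifP; lia.
elim: q x => [|a q IH] x /=; first by rewrite andbT; apply: h.
by case/andP => /h -> /IH ->.
Qed.

Lemma lside_triangle y x z : (lside x z <= lside x y + lside y z)%N.
Proof. by rewrite /lside -big_split /=; apply: leq_sum => i _; lia. Qed.

Lemma side_triangle b x q y : (side x q y <= lside x b + side b q y)%N.
Proof.
case: q => [|a q] /=; first exact: lside_triangle.
by rewrite addnA leq_add2r lside_triangle.
Qed.

Lemma side_subseq x q q' y : subseq q' q -> (side x q' y <= side x q y)%N.
Proof.
elim: q q' x => [|a q IH] q' x; first by rewrite subseq0 => /eqP ->.
case: q' => [|b q'] h.
  by apply: leq_trans (side_triangle a x [::] y) _; rewrite leq_add2l IH ?sub0seq.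
move: h => /=; case: eqVneq => [->|_] h /=; first by rewrite leq_add2l IH.
apply: leq_trans (side_triangle a x (b :: q') y) _.
by rewrite leq_add2l IH.
Qed.

Lemma side_map (f : site d -> site d) x x' q y y' :
  (forall i, i \notin I -> x' i = x i) -> (forall i, i \notin I -> y' i = y i) ->
  (forall u, u \in q -> forall i, i \notin I -> f u i = u i) ->
  side x' (map f q) y' = side x q y.
Proof.
have h u u' v v' : (forall i, i \notin I -> u' i = u i) ->
    (forall i, i \notin I -> v' i = v i) -> lside u' v' = lside u v.
  by move=> hu hv; apply: eq_bigr => i; rewrite inE => iI; rewrite hu ?hv.
move=> hx hy; elim: q x x' hx => [|a q IH] x x' hx hf /=; first exact: h.
rewrite (IH a (f a)) => [||u uq]; first by rewrite (h x _ a) //; apply: hf; rewrite mem_head.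
  by apply: hf; rewrite mem_head.
by apply: hf; rewrite inE uq orbT.
Qed.

Definition smax x y : site d := [ffun i => Num.max (x i) (y i)].

(** Dropped sites enter the running maximum too, so that the reason for dropping a site can be read
    coordinate by coordinate from [nonrecords]. *)
Fixpoint records y x q :=
  if q is a :: q' then
    if slt x a && slt a y then a :: records y (smax x a) q' else records y (smax x a) q'
  else [::].

Lemma records_subseq y x q : subseq (records y x q) q.
Proof.
elim: q x => //= a q IH x; case: ifP => _; first by rewrite eqxx IH.
by apply: subseq_trans (IH _) (subseq_cons _ _).
Qed.

Lemma records_slt y x q : all (slt x) (records y x q).
Proof.
elim: q x => //= a q IH x.
have h : all (slt x) (records y (smax x a) q).
  apply: sub_all (IH (smax x a)) => v; apply: sle_slt_trans.
  by apply/forall_inP => i _; rewrite ffunE le_max lexx.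
by case: ifP => //= /andP[-> _].
Qed.

Lemma records_sorted y x q : sorted slt (rcons (records y x q) y).
Proof.
elim: q x => //= a q IH x; case: ifP => // /andP[_ ay].
rewrite rcons_cons /=; have := records_slt y (smax x a) q; have := IH (smax x a).
case: (records _ _ q) => [|h r] /=; first by rewrite ay.
move=> -> /andP[xh _]; rewrite andbT; apply: sle_slt_trans xh.
by apply/forall_inP => i _; rewrite ffunE le_max lexx orbT.
Qed.

(** A dropped site fails in some coordinate, where it is a non-record or has already reached [y];
    union bound over the coordinates. *)
Lemma records_size y x q : (size q <= size (records y x q) +
  \sum_(i in I) (nonrecords (x i) [seq v i | v : site d <- q] +
                 count (fun a => y i <= a)%R [seq v i | v : site d <- q]))%N.
Proof.
elim: q x => [|a q IH] x //=.
have := IH (smax x a).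
set S := (\sum_(i in I) _)%N; set S' := (\sum_(i in I) _)%N.
have -> : S' = (\sum_(i in I) ((a i <= x i)%R + (y i <= a i)%R) + S)%N.
  by rewrite /S -big_split /=; apply: eq_bigr => i _; rewrite ffunE; lia.
case: ifP => [_ /=|]; first by lia.
move=> /negbT; rewrite negb_and => h.
suff : (0 < \sum_(i in I) ((a i <= x i)%R + (y i <= a i)%R))%N by lia.
have [i iI hi] : exists2 i, i \in I & ((a i <= x i) || (y i <= a i))%R.
  by case/orP: h => /forall_inPn[i iI]; rewrite -leNgt => hi; exists i; rewrite // hi ?orbT.
by rewrite (bigD1 i) //=; move: hi; do 2!case: (_ <= _)%R.
Qed.

Lemma backlogs_sum x q y :
  (\sum_(i in I) backlogs (x i) [seq v i | v : site d <- q] (y i) =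
   stalls x q y + desc x q y)%N.
Proof.
have h u v : (\sum_(i in I) backlog (v i - u i)%R = lstall u v + ldesc u v)%N.
  rewrite /lstall /ldesc -big_split /=; apply: eq_bigr => i _.
  by rewrite /backlog; case: ifP => _ //=; lia.
elim: q x => [|a q IH] x /=; first exact: h.
by rewrite big_split /= h IH; lia.
Qed.

(** The first site is compared with the origin only weakly, so the origin itself may belong to the
    chain. *)
Definition strict_chain A y q :=
  [&& all A q, all (sle (origin d)) q & sorted slt (rcons q y)].

Lemma strict_chain_monotone A y q : sle (origin d) y -> strict_chain A y q ->
  path sle (origin d) (rcons q y).
Proof.
move=> h /and3P[_ hq hs]; have : path sle (origin d) (rcons q y) = sle (origin d) (head y q) && sorted sle (rcons q y).
  by case: q {hq hs} => //=; rewrite andbT.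
move=> ->; apply/andP; split; last by apply: sub_sorted hs; apply: slt_sle.
by case: q hq {hs} => //= a q /andP[].
Qed.

(* Backward moves cost exactly what dropping the non-records saves, so only the
   stalled coordinates are paid for. *)
Lemma strictify A y q : sle (origin d) y -> all A q -> exists2 q',
  strict_chain A y q' &
  (chlen (origin d) q' y + size q <=
     size q' + chlen (origin d) q y + 2 * stalls (origin d) q y)%N.
Proof.
move=> hy Aq; set o := origin d; exists (records y o q).
  apply/and3P; split; last exact: records_sorted.
    by apply/allP => v /(mem_subseq (records_subseq y o q)) vq; apply: (allP Aq).
  by apply: sub_all (records_slt y o q) => v; apply: slt_sle.
have sc : strict_chain predT y (records y o q).
  apply/and3P; split; [exact: all_predT| |exact: records_sorted].
  by apply: sub_all (records_slt y o q) => v; apply: slt_sle.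
have d0 := desc_monotone (strict_chain_monotone hy sc).
have c1 := chlen_decomp o (records y o q) y; have c2 := chlen_decomp o q y.
have ss := side_subseq o y (records_subseq y o q).
have rs := records_size y o q.
have : (\sum_(i in I) (nonrecords (o i) [seq v i | v : site d <- q] +
     count (fun a => y i <= a)%R [seq v i | v : site d <- q]) <=
   \sum_(i in I) 2 * backlogs (o i) [seq v i | v : site d <- q] (y i))%N.
  (* Non-records and entries beyond [y] are each bounded by the backlog; the resulting [2 * desc]
     cancels the descent term of [chlen_decomp]. *)
  apply: leq_sum => i iI; rewrite mul2n -addnn leq_add //.
    by have := @nonrecords_le (o i) (o i) [seq v i | v : site d <- q] (y i) (lexx _); rewrite subrr addn0.
  have := count_ge_le (o i) [seq v i | v : site d <- q] (y i); lia.
rewrite -/o in d0; rewrite -big_distrr /= backlogs_sum.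
move: rs; set S := (\sum_(i in I) _)%N; move: c1 c2 ss; rewrite d0; clear; lia.
Qed.

Lemma strict_time_ex A y : exists n,
  `[< exists2 q, strict_chain A y q & (chlen (origin d) q y <= size q + n)%N >].
Proof. by exists (l1 (origin d) y); apply/asboolP; exists [::]. Qed.

(** The passage time amounts to the least value of length minus number of sites over chains of open
    sites; here only strict chains compete. *)
Definition strict_time A y : nat := ex_minn (strict_time_ex A y).

Lemma strict_time_le A y q n : strict_chain A y q ->
  (chlen (origin d) q y <= size q + n)%N -> (strict_time A y <= n)%N.
Proof.
by move=> ? ?; rewrite /strict_time; case: ex_minnP => m _; apply; apply/asboolP; exists q.
Qed.

Lemma strict_timeP A y : exists2 q, strict_chain A y q &
  (chlen (origin d) q y <= size q + strict_time A y)%N.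
Proof. by rewrite /strict_time; case: ex_minnP => m /asboolP. Qed.

Lemma strict_time_le_l1 A y : (strict_time A y <= l1 (origin d) y)%N.
Proof. by apply: (@strict_time_le _ _ [::]). Qed.

Lemma strict_time_mono A B y : subpred A B -> (strict_time B y <= strict_time A y)%N.
Proof.
move=> AB; have [q /and3P[qA q0 qs] hq] := strict_timeP A y.
by apply: strict_time_le hq; apply/and3P; split => //; apply: sub_all qA.
Qed.

Lemma strict_time_chain A y : sle (origin d) y -> exists q,
  [/\ uniq q, all A q,
      (strict_time A y <= ptime A (origin d) y + 2 * stalls (origin d) q y)%N &
      (chlen (origin d) q y <= size q + ptime A (origin d) y)%N].
Proof.
move=> hy; have [q [uq Aq hq]] := open_chain A (origin d) y.
exists q; split => //; have [q' sq' h] := strictify hy Aq.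
by apply: strict_time_le sq' _; lia.
Qed.

(** Converse of [open_chain]: join consecutive sites by walks; [a] and each site of [q] save one
    step, being left for a different site. *)
Lemma ptime_chain_open A a q y : A a -> all A q ->
  path (fun u v => u != v) a (rcons q y) -> (ptime A a y + size q < chlen a q y)%N.
Proof.
elim: q a => [|b q IH] a Aa /=; first by rewrite andbT addn0 => _; apply: ptime_open.
move=> /andP[Ab Aq] /andP[ab hp].
have := IH b Ab Aq hp; have := ptime_open Aa ab; have := ptime_triangle A b a y; lia.
Qed.

Lemma ptime_chain A x q y : all A q ->
  sorted (fun u v => u != v) (rcons q y) -> (ptime A x y + size q <= chlen x q y)%N.
Proof.
case: q => [|a q] /=; first by rewrite addn0 ptime_le_l1.
move=> /andP[Aa Aq] hp; have := ptime_chain_open Aa Aq hp.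
have := ptime_triangle A a x y; have := ptime_le_l1 A x a; lia.
Qed.

Definition dilate (k : 'I_d -> nat) y : site d := [ffun i => (k i)%:Z * y i].

Hypothesis I_neq0 : I != finset.set0.

Lemma slt_neq x y : slt x y -> x != y.
Proof.
move=> /forall_inP h; have /set0Pn[i iI] := I_neq0.
by apply/eqP => e; have := h i iI; rewrite e ltxx.
Qed.

(** The chain and its lift are monotone, hence without descent; they have as many sites, and the
    same sideways length because the boxes have side 1 off [I]. Length minus number of sites changes
    by the change of drift alone. *)
Lemma coarse_grain (k : 'I_d -> nat) A A' y :
  (forall i, 0 < k i)%N -> (forall i, i \notin I -> k i = 1%N) ->
  sle (origin d) y ->
  (forall u, A' u -> exists2 x, A x &
     forall i, ((k i)%:Z * u i <= x i < (k i)%:Z * (u i + 1))%R) ->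
  (ptime A (origin d) (dilate k y) + l1 (origin d) y <=
     strict_time A' y + l1 (origin d) (dilate k y))%N.
Proof.
move=> k0 k1 hy hA; set o := origin d; set Y := dilate k y.
have /choice[f hf] u : exists x, A' u -> A x /\
    forall i, ((k i)%:Z * u i <= x i < (k i)%:Z * (u i + 1))%R.
  have [/hA[x Ax hx]|nA] := boolP (A' u); first by exists x.
  by exists u.
have [q sq hq] := strict_timeP A' y.
have /and3P[qA q0 qs] := sq.
(* Strictness enters here: [u i < v i] puts the whole box of [u] before the lower corner of the box
   of [v]. *)
have fslt u v : A' u -> slt u v -> slt (f u) (dilate k v).
  move=> /hf[_ fu] /forall_inP uv; apply/forall_inP => i iI; rewrite ffunE.
  by have := fu i; have := uv i iI; have := k0 i; nia.
have fsle u : A' u -> sle (dilate k u) (f u).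
  by move=> /hf[_ fu]; apply/forall_inP => i iI; rewrite ffunE; have /andP[] := fu i.
have Afq : all A (map f q).
  by rewrite all_map; apply: sub_all qA => u /hf[].
have sY : sle o Y.
  apply/forall_inP => i iI; have := forall_inP hy i iI; rewrite !ffunE; have := k0 i; nia.
have fs : strict_chain A Y (map f q).
  apply/and3P; split => //.
    apply/allP => _ /mapP[u uq ->]; apply/forall_inP => i iI.
    have := forall_inP (allP q0 _ uq) i iI; have := forall_inP (fsle u (allP qA _ uq)) i iI.
    rewrite !ffunE; have := k0 i; clear; nia.
  elim: q qA qs {hq sq q0 Afq} => //= a q IH /andP[Aa Aq] hs.
  have {IH} := IH Aq; case: q hs Aq => [|b q] /=.
    by rewrite !andbT => hs _ _; apply: fslt.
  move=> /andP[ab hs] /andP[Ab Aq] /(_ hs) ->; rewrite andbT.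
  have := fslt a b Aa ab; have := fsle b Ab => /forall_inP h1 /forall_inP h2.
  by apply/forall_inP => i iI; apply: lt_le_trans (h2 i iI) (h1 i iI).
have pc : (ptime A o Y + size (map f q) <= chlen o (map f q) Y)%N.
  apply: ptime_chain => //; case/and3P: fs => _ _; apply: sub_sorted => u v; exact: slt_neq.
have c1 := chlen_decomp o (map f q) Y; have c2 := chlen_decomp o q y.
have c3 := l1_decomp o Y; have c4 := l1_decomp o y.
have e1 := desc_monotone (strict_chain_monotone sY fs).
have e2 := desc_monotone (strict_chain_monotone hy sq).
have e3 := @desc_monotone o [::] y; have e4 := @desc_monotone o [::] Y.
rewrite /= andbT in e3; rewrite /= andbT in e4.
rewrite size_map in pc.
have s1 : side o (map f q) Y = side o q y.
  apply: side_map => // [i iI|u uq i iI]; first by rewrite ffunE k1 // mul1r.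
  have [_ /(_ i)] := hf u (allP qA _ uq); rewrite k1 // !mul1r; clear; lia.
have s2 : lside o Y = lside o y.
  by apply: eq_bigr => i; rewrite inE => iI; rewrite !ffunE k1 // mul1r.
rewrite -/o in hq e1 e2.
move: c1 c2 c3 c4 pc hq; rewrite e1 e2 (e3 hy) (e4 sY) s1 s2; clear; lia.
Qed.

End StrictChains.

(** * Bernoulli fields on finite sets *)

Section Expectation.
Variable R : realType.
Implicit Types (U V K X : finType) (e : R).

Definition bern e (b : bool) : R := if b then e else 1 - e.

Definition expect V e (F : {ffun V -> bool} -> R) : R :=
  \sum_(w : {ffun V -> bool}) (\prod_v bern e (w v)) * F w.

(** Image measure: sites carry independent labels of law [p], and [phi] reads a Bernoulli bit off a
    label. It serves both the coupling of two parameters and the passage from sites to boxes. *)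
Lemma expect_push V X (p : X -> R) (phi : X -> bool) e (F : {ffun V -> bool} -> R) :
  (forall b, \sum_(x | phi x == b) p x = bern e b) ->
  \sum_(w : {ffun V -> X}) (\prod_v p (w v)) * F [ffun v => phi (w v)] = expect e F.
Proof.
move=> hp; rewrite (partition_big (fun w : {ffun V -> X} => [ffun v => phi (w v)]) predT) //=.
apply: eq_bigr => h _; under eq_bigr => w /eqP -> do [].
rewrite -mulr_suml; congr (_ * _).
under [RHS]eq_bigr => v _ do rewrite -hp.
rewrite bigA_distr_big_dep /=; apply: eq_bigl => w.
apply/eqP/familyP => [E v|H]; first by rewrite unfold_in /= -E ffunE.
by apply/ffunP => v; rewrite ffunE; apply/eqP; have := H v; rewrite unfold_in.
Qed.

Lemma sum_bern e : \sum_b bern e b = 1.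
Proof. by rewrite big_bool /= addrC subrK. Qed.

Lemma prod_bern_sum V e : \sum_(w : {ffun V -> bool}) \prod_v bern e (w v) = 1.
Proof. by rewrite -(bigA_distr_bigA (fun _ => bern e)) big1 // => v _; apply: sum_bern. Qed.

Lemma expect_const V e (c : R) : expect e (fun _ : {ffun V -> bool} => c) = c.
Proof. by rewrite /expect -mulr_suml prod_bern_sum mul1r. Qed.

Lemma expect_add V e (F G : {ffun V -> bool} -> R) :
  expect e (fun w => F w + G w) = expect e F + expect e G.
Proof. by rewrite /expect -big_split; apply: eq_bigr => w _; rewrite mulrDr. Qed.

Lemma expect_scale V e c (F : {ffun V -> bool} -> R) :
  expect e (fun w => c * F w) = c * expect e F.
Proof. by rewrite /expect mulr_sumr; apply: eq_bigr => w _; rewrite mulrCA. Qed.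

Lemma expect_sum V e (J : Type) (r : seq J) (F : J -> {ffun V -> bool} -> R) :
  expect e (fun w => \sum_(j <- r) F j w) = \sum_(j <- r) expect e (F j).
Proof. by rewrite /expect exchange_big; apply: eq_bigr => w _; rewrite mulr_sumr. Qed.

Lemma expect_le V e (F G : {ffun V -> bool} -> R) : 0 <= e <= 1 ->
  (forall w, F w <= G w) -> expect e F <= expect e G.
Proof.
move=> /andP[e0 e1] h; apply: ler_sum => w _; apply: ler_wpM2l => //.
by apply: prodr_ge0 => v _; rewrite /bern; case: ifP; rewrite ?subr_ge0.
Qed.

(** Marginal law: the bits off the range of [j] sum out to 1. *)
Lemma expect_pull U V (j : U -> V) e (F : {ffun U -> bool} -> R) : injective j ->
  expect e (fun w : {ffun V -> bool} => F [ffun u => w (j u)]) = expect e F.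
Proof.
move=> ij; rewrite /expect.
rewrite (partition_big (fun w : {ffun V -> bool} => [ffun u => w (j u)]) predT) //=.
apply: eq_bigr => h _; under eq_bigr => w /eqP -> do [].
rewrite -mulr_suml; congr (_ * _).
(* Bits allowed at [v]: the one prescribed by [h] on the range of [j], both elsewhere. *)
pose Q v := [pred b : bool | [forall u, (j u == v) ==> (b == h u)]].
have -> : \sum_(w : {ffun V -> bool} | [ffun u => w (j u)] == h) \prod_v bern e (w v) =
    \sum_(w in family Q) \prod_v bern e (w v).
  apply: eq_bigl => w; apply/eqP/familyP => [E v|H].
    by rewrite inE; apply/forallP => u; apply/implyP => /eqP <-; rewrite -E ffunE.
  apply/ffunP => u; rewrite ffunE; have := H (j u); rewrite inE => /forallP/(_ u).
  by rewrite eqxx => /eqP.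
rewrite -(bigA_distr_big_dep Q (fun _ => bern e)) (bigID (mem (j @: [set: U]%SET))) /=.
rewrite [X in _ * X]big1 ?mulr1 => [|v nv].
  rewrite big_imset; last by move=> ? ? _ _; apply: ij.
  rewrite [RHS](eq_bigl (mem [set: U]%SET)); last by move=> u; rewrite /= inE.
  apply: eq_bigr => u _; rewrite (big_pred1 (h u)) // => b /=.
  apply/forallP/eqP => [/(_ u)|-> u']; first by rewrite eqxx => /eqP.
  by apply/implyP => /eqP/ij ->.
rewrite -[RHS](sum_bern e); apply: eq_bigl => b.
apply/forallP => u; apply/implyP => /eqP ju; case/negP: nv.
by apply/imsetP; exists u; rewrite ?inE.
Qed.

(* Monotone coupling: p is the joint law of two Bernoulli variables, the first
   below the second. *)
Lemma expect_antitone V e e' (F : {ffun V -> bool} -> R) : 0 <= e -> e <= e' -> e' <= 1 ->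
  (forall w w' : {ffun V -> bool}, (forall v, w v -> w' v) -> F w' <= F w) -> expect e' F <= expect e F.
Proof.
move=> e0 ee' e1 hF.
pose p (x : bool * bool) : R :=
  if x.1 then (if x.2 then e else 0) else (if x.2 then e' - e else 1 - e').
have h1 b : \sum_(x | x.1 == b) p x = bern e b.
  transitivity (\sum_c \sum_c' if c == b then p (c, c') else 0).
    by rewrite pair_bigA /= [LHS]big_mkcond; apply: eq_bigr => -[].
  by rewrite !big_bool /p /bern /=; case: b => /=; ring.
have h2 b : \sum_(x | x.2 == b) p x = bern e' b.
  transitivity (\sum_c \sum_c' if c' == b then p (c, c') else 0).
    by rewrite pair_bigA /= [LHS]big_mkcond; apply: eq_bigr => -[].
  by rewrite !big_bool /p /bern /=; case: b => /=; ring.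
rewrite -(expect_push F h1) -(expect_push F h2); apply: ler_sum => w _.
have [->|nz] := eqVneq (\prod_v p (w v)) 0; first by rewrite !mul0r.
apply: ler_wpM2l.
  by apply: prodr_ge0 => v _; rewrite /p; do !case: ifP => _ //; lra.
apply: hF => v; rewrite !ffunE; case wv: (w v) => [[] []] //= _.
case/negP: nz; apply/eqP; rewrite (bigD1 v) //= wv /p /= mul0r //.
Qed.

(** Currying makes a configuration on [V * K] a family of independent blocks; a block is closed only
    when all its sites are, which is a single configuration of the block. *)
Lemma expect_or V K e (F : {ffun V -> bool} -> R) :
  expect e (fun w : {ffun V * K -> bool} => F [ffun v => [exists o, w (v, o)]]) =
  expect (1 - (1 - e) ^+ #|K|) F.
Proof.
pose p (x : {ffun K -> bool}) : R := \prod_o bern e (x o).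
have hf : \sum_(x : {ffun K -> bool} | [exists o, x o] == false) p x = (1 - e) ^+ #|K|.
  rewrite (big_pred1 [ffun=> false]) => [|x] /=.
    by rewrite /p; under eq_bigr do rewrite ffunE; rewrite prodr_const.
  apply/idP/eqP => [|->].
    rewrite eqbF_neg negb_exists => /forallP h; apply/ffunP => o; rewrite ffunE.
    exact/negbTE/h.
  by rewrite eqbF_neg negb_exists; apply/forallP => o; rewrite ffunE.
have hp b : \sum_(x : {ffun K -> bool} | [exists o, x o] == b) p x =
    bern (1 - (1 - e) ^+ #|K|) b.
  case: b; rewrite /bern /=; last by rewrite hf; ring.
  rewrite -hf -(prod_bern_sum K e) [X in _ = X - _](bigID (fun x : {ffun K -> bool} => [exists o, x o] == true)) /=.
  rewrite -[LHS]addr0 -addrA; congr (_ + _); apply/esym/eqP; rewrite subr_eq0; apply/eqP.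
  by apply: eq_bigl => x; case: [exists _, _].
rewrite -(expect_push F hp) /expect.
pose g (w : {ffun V -> {ffun K -> bool}}) : {ffun V * K -> bool} := [ffun q => w q.1 q.2].
pose g' (w : {ffun V * K -> bool}) : {ffun V -> {ffun K -> bool}} := [ffun v => [ffun o => w (v, o)]].
rewrite (reindex g); last first.
  exists g' => w _; first by apply/ffunP => v; apply/ffunP => o; rewrite !ffunE.
  by apply/ffunP => -[v o]; rewrite !ffunE.
apply: eq_bigr => w _; congr (_ * F _).
  transitivity (\prod_v \prod_o bern e (g w (v, o))).
    by rewrite pair_bigA; apply: eq_bigr => -[].
  by apply: eq_bigr => v _; apply: eq_bigr => o _; rewrite ffunE.
by apply/ffunP => v; rewrite !ffunE; apply: eq_existsb => o; rewrite ffunE.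
Qed.

Lemma expect_all V e (q : seq V) : uniq q ->
  expect e (fun w : {ffun V -> bool} => (all w q)%:R) = e ^+ size q.
Proof.
move=> uq; pose G v (b : bool) : R := bern e b * (if v \in q then b%:R else 1).
transitivity (\prod_v \sum_b G v b).
  rewrite bigA_distr_bigA; apply: eq_bigr => w _; rewrite big_split /=; congr (_ * _).
  have [/allP h|/allPn[v vq nw]] := boolP (all w q).
    by rewrite big1 // => v _; case: ifP => // /h ->.
  by rewrite (bigD1 v) //= vq (negbTE nw) mul0r.
rewrite -(card_uniqP uq) -prodr_const [RHS]big_mkcond /=; apply: eq_bigr => v _.
by rewrite big_bool /G /=; case: ifP => _; ring.
Qed.

End Expectation.

(** * Mean passage times: finite windows, symmetries, subadditivity *)

Section BoxModel.
Variables (R : realType) (d : nat).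
Implicit Types (e : R) (y : site d).

(** Sites outside the range of [f] are closed, so enlarging the window can only shorten passage
    times. *)
Definition config (V : finType) (f : V -> site d) (w : {ffun V -> bool}) : pred (site d) :=
  fun x => [exists v, (f v == x) && w v].

Lemma configE (V : finType) (f : V -> site d) w v : injective f -> config f w (f v) = w v.
Proof.
move=> fi; apply/existsP/idP => [[u /andP[/eqP/fi ->]]//|wv].
by exists v; rewrite eqxx.
Qed.

Definition box (N : nat) : finType := {ffun 'I_d -> 'I_(N.*2.+1)}.

Definition box_site N (v : box N) : site d := [ffun i => (v i)%:Z - N%:Z].

Lemma box_site_inj N : injective (@box_site N).
Proof.
move=> u v /ffunP h; apply/ffunP => i; apply/val_inj => /=.
by have := h i; rewrite !ffunE => /addIr[].
Qed.

Lemma box_embed (V : finType) (f : V -> site d) : injective f ->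
  exists N0, forall N, (N0 <= N)%N ->
    exists2 j : V -> box N, injective j & forall v, box_site (j v) = f v.
Proof.
move=> fi; exists (\max_v \max_i absz (f v i))%N => N hN.
have b v i : (absz (f v i) <= N)%N.
  apply: leq_trans hN; apply: leq_trans (leq_bigmax v).
  exact: (leq_bigmax (F := fun i => absz (f v i)) i).
pose j v : box N := [ffun i => inord (absz (f v i + N%:Z))].
have jE v : box_site (j v) = f v.
  apply/ffunP => i; have := b v i; rewrite !ffunE => h; rewrite inordK.
    by move: (f v i) h => c; clear; lia.
  by move: (f v i) h => c; clear; lia.
by exists j => // u v /(congr1 (@box_site N)); rewrite !jE => /fi.
Qed.

Definition box_time N e y : R :=
  expect e (fun w => (ptime (config (@box_site N) w) (origin d) y)%:R).

(* Passage times decrease as the box grows, so this infimum is also the limit,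
   the mean passage time in the environment on the whole lattice. *)
Definition mean_time e y : R := inf (range (fun N => box_time N e y)).

Section Fixed.
Variables (e : R) (e01 : 0 <= e <= 1).

Lemma box_time_ge0 N y : 0 <= box_time N e y.
Proof. by rewrite -(expect_const (box N) e 0); apply: expect_le. Qed.

Lemma mean_time_le_box N y : mean_time e y <= box_time N e y.
Proof. by apply: ge_inf; [exists 0 => _ [M _ <-]; apply: box_time_ge0|exists N]. Qed.

Lemma mean_time_ge c y : (forall N, c <= box_time N e y) -> c <= mean_time e y.
Proof. by move=> h; apply: lb_le_inf; [exists (box_time 0 e y), 0%N|move=> _ [N _ <-]]. Qed.

Lemma mean_time_ge0 y : 0 <= mean_time e y.
Proof. by apply: mean_time_ge => N; apply: box_time_ge0. Qed.

Lemma box_time_restrict (V : finType) (f : V -> site d) (x y : site d) N (j : V -> box N) :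
  injective j -> (forall v, box_site (j v) = f v) ->
  expect e (fun w => (ptime (config (@box_site N) w) x y)%:R) <=
  expect e (fun w => (ptime (config f w) x y)%:R) :> R.
Proof.
move=> ji jf; rewrite -[leRHS](expect_pull _ _ ji); apply: expect_le => // w.
rewrite ler_nat; apply: ptime_mono => u /existsP[v /andP[/eqP <-]].
by rewrite ffunE -jf configE //; apply: box_site_inj.
Qed.

Lemma mean_time_le_expect (V : finType) (f : V -> site d) y : injective f ->
  mean_time e y <= expect e (fun w => (ptime (config f w) (origin d) y)%:R).
Proof.
move=> fi; have [N /(_ N (leqnn _)) [j ji jf]] := box_embed fi.
exact: le_trans (mean_time_le_box N y) (box_time_restrict _ _ ji jf).
Qed.

Lemma mean_time_map (f : site d -> site d) y :
  (forall u v, neighbor u v -> neighbor (f u) (f v)) -> injective f ->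
  f (origin d) = origin d -> mean_time e (f y) <= mean_time e y.
Proof.
move=> fn fi f0; apply: mean_time_ge => N.
apply: le_trans (mean_time_le_expect (f := f \o @box_site N) (f y) _) _.
  exact: inj_comp fi (@box_site_inj N).
apply: expect_le => // w; rewrite ler_nat -{1}f0; apply: ptime_map => // u.
by case/existsP => v /andP[/eqP <- wv]; apply/existsP; exists v; rewrite eqxx.
Qed.

Lemma mean_time_lip y y' : mean_time e y <= mean_time e y' + (l1 y' y)%:R.
Proof.
rewrite -lerBlDr; apply: mean_time_ge => N; rewrite lerBlDr.
apply: le_trans (mean_time_le_box N y) _.
rewrite -[X in _ <= _ + X](expect_const (box N) e) -expect_add; apply: expect_le => // w.
rewrite -natrD ler_nat; apply: leq_trans (ptime_triangle _ y' _ _) _.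
by rewrite leq_add2l ptime_le_l1.
Qed.

Lemma mean_time_origin : mean_time e (origin d) = 0.
Proof.
apply/le_anti; rewrite mean_time_ge0 andbT.
apply: le_trans (mean_time_le_box 0 _) _.
rewrite -(expect_const (box 0) e 0); apply: expect_le => // w.
by rewrite lern0 -leqn0; apply: leq_trans (ptime_le_l1 _ _ _) _; rewrite l1xx.
Qed.

Lemma mean_time_le_l1 y : mean_time e y <= (l1 (origin d) y)%:R.
Proof. by have := mean_time_lip y (origin d); rewrite mean_time_origin add0r. Qed.

Lemma neighbor_translate (x u v : site d) : neighbor u v -> neighbor (x + u) (x + v).
Proof.
rewrite /neighbor => /eqP <-; apply/eqP/eq_bigr => i _; rewrite !ffunE; ring.
Qed.

(** A common box [M] contains the box [N] and the translate by [y] of the box [N']. The two halves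
    of the walk are bounded separately, each through its marginal, and a translation brings the
    second one back to the origin. *)
Lemma mean_time_subadd y y' : mean_time e (y + y') <= mean_time e y + mean_time e y'.
Proof.
rewrite -lerBlDr; apply: mean_time_ge => N; rewrite lerBlDr [leRHS]addrC -lerBlDr.
apply: mean_time_ge => N'; rewrite lerBlDr [leRHS]addrC.
have [N1 h1] := box_embed (@box_site_inj N).
have [N2 h2] := box_embed (inj_comp (addrI y) (@box_site_inj N')).
pose M := maxn N1 N2.
have [j1 i1 e1] := h1 M (leq_maxl _ _); have [j2 i2 e2] := h2 M (leq_maxr _ _).
apply: le_trans (mean_time_le_box M _) _.
apply: le_trans (_ : expect e (fun w => (ptime (config (@box_site M) w) (origin d) y)%:R +
   (ptime (config (@box_site M) w) y (y + y'))%:R) <= _).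
  by apply: expect_le => // w; rewrite -natrD ler_nat ptime_triangle.
rewrite expect_add; apply: lerD; first exact: box_time_restrict i1 e1.
apply: le_trans (box_time_restrict _ _ i2 e2) _.
have y0 : y = y + origin d by apply/ffunP => i; rewrite !ffunE addr0.
apply: expect_le => // w; rewrite ler_nat {2}y0.
apply: (ptime_map (f := +%R y)) => [u v|u]; first exact: neighbor_translate.
by case/existsP => v /andP[/eqP <- wv]; apply/existsP; exists v; rewrite eqxx.
Qed.

End Fixed.
End BoxModel.

(** * First moment bound *)

Section LineSums.
Variable R : realType.

Lemma expR1_ge2 : 2 <= expR (1 : R).
Proof. by have := expR_ge1Dx (1 : R). Qed.

(** Telescoping in place of a geometric series: [H] is a bounded function whose increments dominate
    [f], so the bound depends neither on the window nor on its position. *)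
Lemma sum_le_potential (f H : int -> R) (B : R) (c : int) (n : nat) :
  (forall t, f t <= H (t + 1) - H t) -> (forall t, 0 <= H t <= B) ->
  \sum_(j < n) f (j%:Z - c) <= B.
Proof.
move=> fH HB.
apply: le_trans (_ : \sum_(j < n) (H (j.+1%:Z - c) - H (j%:Z - c)) <= _).
  apply: ler_sum => j _; apply: le_trans (fH _) _.
  by rewrite (_ : j%:Z - c + 1 = j.+1%:Z - c) //; lia.
rewrite -(big_mkord xpredT (fun j => H (j.+1%:Z - c) - H (j%:Z - c))).
rewrite telescope_sumr //.
by have := HB (n%:Z - c); have := HB (0%:Z - c); lra.
Qed.

Lemma sum_side (c : int) (n : nat) : \sum_(j < n) expR (- `|(j%:Z - c)%:~R|) <= 4 :> R.
Proof.
pose H (t : int) : R := if (t <= 0)%R then 2 * expR t%:~R else 4 - 2 * expR (- t%:~R).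
apply: (@sum_le_potential (fun t => expR (- `|t%:~R|)) H) => t.
  have e2 := expR1_ge2.
  rewrite /H; case: (ltgtP t 0) => [t0|t0|->].
  - have -> : (t + 1 <= 0) by lia.
    rewrite ltr0_norm ?ltrz0 // opprK intrD expRD.
    by have := expR_gt0 (t%:~R : R); nra.
  - have -> : (t + 1 <= 0) = false by lia.
    rewrite gtr0_norm ?ltr0z // intrD opprD expRD (expRN 1).
    have : (expR 1)^-1 <= 2^-1 :> R by rewrite lef_pV2 ?posrE ?expR_gt0.
    by have := expR_gt0 (- t%:~R : R); nra.
  - rewrite add0r /= mulr0z normr0 oppr0 expR0 expRN mulr1z.
    have : (expR 1)^-1 <= 2^-1 :> R by rewrite lef_pV2 ?posrE ?expR_gt0.
    lra.
rewrite /H; case: (leP t 0) => t0.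
  have : expR t%:~R <= 1 :> R by rewrite -[leRHS]expR0 ler_expR lerz0.
  by have := expR_gt0 (t%:~R : R); lra.
have : expR (- t%:~R) <= 1 :> R by rewrite -[leRHS]expR0 ler_expR oppr_le0 ler0z ltW.
by have := expR_gt0 (- t%:~R : R); lra.
Qed.

(** Forward jumps sum to 1/(e^s - 1), at most [s^-1]; the others, jump 0 included, stay below
    [expR (p + 1)]. *)
Lemma sum_forward (s p : R) (c : int) (n : nat) : 0 < s ->
  \sum_(j < n) (if (0 < j%:Z - c)%R then expR (- s * (j%:Z - c)%:~R)
                else expR (p + (j%:Z - c)%:~R)) <= expR (p + 1) + s^-1.
Proof.
move=> s0.
pose H (t : int) : R := if (t <= 0)%R then expR (p + t%:~R)
  else expR (p + 1) + s^-1 * (1 - expR (- s * (t - 1)%:~R)).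
apply: (@sum_le_potential (fun t => if (0 < t)%R then expR (- s * t%:~R)
                else expR (p + t%:~R)) H) => t.
  have e2 := expR1_ge2.
  rewrite /H; case: (ltgtP t 0) => [t0|t0|->].
  - have -> : (t + 1 <= 0) by lia.
    rewrite intrD !addrA [expR (_ + _ + _)]expRD mulr1z.
    by have := expR_gt0 (p + t%:~R); nra.
  - have -> : (t + 1 <= 0) = false by lia.
    have -> : - s * (t - 1)%:~R = - s * t%:~R + s by rewrite intrB mulr1z; ring.
    rewrite addrK (expRD (- s * _)).
    set E := expR (- s * _); have E0 : 0 < E by apply: expR_gt0.
    have : 1 + s <= expR s by apply: expR_ge1Dx.
    have ss : s^-1 * s = 1 by rewrite mulVf // gt_eqF.
    have s1 : 0 < s^-1 by rewrite invr_gt0.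
    move=> h; have h' : s^-1 * s <= s^-1 * (expR s - 1) by rewrite ler_pM2l //; lra.
    have : E * (s^-1 * s) <= E * (s^-1 * (expR s - 1)) by rewrite ler_pM2l.
    rewrite ss; lra.
  - rewrite add0r /= subrr !mulr0z !mulr0 expR0 subrr mulr0 !addr0 expRD.
    by have := expR_gt0 p; nra.
have s1 : 0 < s^-1 by rewrite invr_gt0.
rewrite /H; case: (leP t 0) => t0.
  rewrite expR_ge0 /=; apply: ler_wpDr; first exact: ltW.
  by rewrite ler_expR lerD2l (le_trans (_ : _ <= 0)) // lerz0.
have h : expR (- s * (t - 1)%:~R) <= 1.
  rewrite -[leRHS]expR0 ler_expR mulNr oppr_le0; apply: mulr_ge0; first exact: ltW.
  by rewrite ler0z; lia.
have := expR_gt0 (- s * (t - 1)%:~R); have := expR_gt0 (p + 1).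
move: (expR (- s * _)) (expR (p + 1)) h => E E' h E'0 E0; apply/andP; split; nra.
Qed.

End LineSums.

(** * Exponential weights of chains *)

Fixpoint words (V : finType) (m : nat) : seq (seq V) :=
  if m is m'.+1 then [seq v :: q | v <- enum V, q <- words V m'] else [:: [::]].

Lemma mem_words (V : finType) (q : seq V) : q \in words V (size q).
Proof.
elim: q => [|v q IH]; rewrite ?inE //=; apply/allpairsP; exists (v, q).
by rewrite mem_enum.
Qed.

Lemma size_words (V : finType) m (q : seq V) : q \in words V m -> size q = m.
Proof.
elim: m q => [|m IH] q /=; first by rewrite inE => /eqP ->.
by case/allpairsP => -[v r] [_ /IH /= <- ->].
Qed.

Section FirstMoment.
Variables (R : realType) (d : nat) (I : {set 'I_d}) (s theta : R).
Hypotheses (s01 : 0 < s <= 1) (theta0 : 0 <= theta).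
Implicit Types (x y a : site d) (q : seq (site d)).

(* A coordinate in I that does not increase costs 2 |t| steps, of which |t| pay
   for the summability of the weight; it is also charged the bonus 2 theta. *)
Definition coord_weight i (t : int) : R :=
  if i \in I then (if 0 < t then expR (- s * t%:~R) else expR (2 * theta + t%:~R))
  else expR (- `|t%:~R|).

Definition step_weight x a : R := \prod_i coord_weight i (a i - x i).

Fixpoint chain_weight x q y : R :=
  if q is a :: q' then step_weight x a * chain_weight a q' y else step_weight x y.

Lemma coord_weight_gt0 i t : 0 < coord_weight i t.
Proof. by rewrite /coord_weight; do !case: ifP => _; apply: expR_gt0. Qed.

Lemma step_weight_ge0 x a : 0 <= step_weight x a.
Proof. by apply: prodr_ge0 => i _; apply/ltW/coord_weight_gt0. Qed.

Lemma chain_weight_ge0 x q y : 0 <= chain_weight x q y.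
Proof.
by elim: q x => [|a q IH] x /=; rewrite ?mulr_ge0 ?step_weight_ge0.
Qed.

(** Coordinatewise: a forward move t yields (1 - s) t - t = - s t; a stalled one yields 2 theta + (2
    - s) t, at most 2 theta + t as [s <= 1] and t <= 0. The factor 1 - s on the drift is what makes
    forward moves summable. *)
Lemma exp_step_le x a :
  expR (2 * theta * (lstall I x a)%:R + (1 - s) * (drift I x a)%:~R - (l1 x a)%:R)
    <= step_weight x a.
Proof.
have -> : 2 * theta * (lstall I x a)%:R + (1 - s) * (drift I x a)%:~R - (l1 x a)%:R =
   \sum_i ((if i \in I then 2 * theta * (a i - x i <= 0)%R%:R + (1 - s) * (a i - x i)%:~R else 0)
           - `|(a i - x i)%:~R|) :> R.
  rewrite sumrB -big_mkcond /= big_split /= -!mulr_sumr /lstall /drift /l1 !natr_sum.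
  rewrite (raddf_sum (intmul 1)) /=; congr (_ - _).
  by apply: eq_bigr => i _; rewrite -intr_norm -abszE -abszN opprB.
rewrite expR_sum; apply: ler_prod => i _; rewrite expR_ge0 /= /coord_weight.
have /andP[s0 s1] := s01; case: ifP => _; last by rewrite add0r.
move: (a i - x i) => t; case: (ltP 0 t) => t0; rewrite ler_expR.
  by rewrite gtr0_norm ?ltr0z //= mulr0; lra.
have t0' : t%:~R <= 0 :> R by rewrite lerz0.
by rewrite ler0_norm //= mulr1; nra.
Qed.

Lemma exp_chain_le x q y :
  expR (2 * theta * (stalls I x q y)%:R + (1 - s) * (drift I x y)%:~R - (chlen x q y)%:R)
    <= chain_weight x q y.
Proof.
elim: q x => [|a q IH] x /=; first exact: exp_step_le.
rewrite -(drift_add I a x y) !natrD intrD.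
apply: le_trans (_ : _ <= _ * _); last first.
  by apply: ler_pM (exp_step_le x a) (IH a); apply: expR_ge0.
by rewrite -expRD ler_expR; lra.
Qed.

Lemma step_weight_le x y : step_weight x y <= expR (2 * theta * #|I|%:R).
Proof.
have -> : expR (2 * theta * #|I|%:R) = \prod_i (if i \in I then expR (2 * theta) else 1).
  by rewrite -big_mkcond /= prodr_const -expRM_natr.
apply: ler_prod => i _; rewrite (ltW (coord_weight_gt0 _ _)) /= /coord_weight.
have /andP[s0 s1] := s01.
case: ifP => _; last by rewrite -[leRHS]expR0 ler_expR oppr_le0.
case: ltP => t0; rewrite ler_expR.
  have t0' : 0 <= (y i - x i)%:~R :> R by rewrite ler0z ltW.
  by rewrite mulNr (@le_trans _ _ 0) ?oppr_le0 ?mulr_ge0 // ltW.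
have : (y i - x i)%:~R <= 0 :> R by rewrite lerz0.
lra.
Qed.

Definition step_mass : R := (expR (2 * theta + 1) + s^-1) ^+ #|I| * 4 ^+ #|~: I|.

Lemma step_weight_sum N x : \sum_(v : box d N) step_weight x (box_site v) <= step_mass.
Proof.
pose g i (j : 'I_(N.*2.+1)) := coord_weight i (j%:Z - (N%:Z + x i)).
have -> : \sum_(v : box d N) step_weight x (box_site v) =
    \sum_(v : {ffun 'I_d -> 'I_(N.*2.+1)}) \prod_i g i (v i).
  by apply: eq_bigr => v _; apply: eq_bigr => i _; rewrite /g ffunE opprD addrA.
rewrite -bigA_distr_bigA /=.
have -> : step_mass = \prod_i (if i \in I then expR (2 * theta + 1) + s^-1 else 4).
  rewrite (bigID (mem I)) /= /step_mass -!prodr_const; congr (_ * _).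
    by apply: eq_bigr => i ->.
  rewrite (eq_bigl (fun i => i \notin I)) => [|i]; last by rewrite inE.
  by apply: eq_bigr => i /negbTE ->.
have /andP[s0 s1] := s01.
apply: ler_prod => i _; apply/andP; split.
  by apply: sumr_ge0 => j _; apply/ltW/coord_weight_gt0.
rewrite /g /coord_weight; case: (i \in I); first exact: sum_forward.
exact: sum_side.
Qed.

(** Each site is summed out at cost [step_mass]; the closing step to [y] is not summed, and
    [step_weight_le] bounds its weight. *)
Lemma chain_weight_sum N m x y :
  \sum_(q <- words (box d N) m) chain_weight x (map (@box_site d N) q) y <=
  step_mass ^+ m * expR (2 * theta * #|I|%:R).
Proof.
elim: m x => [|m IH] x /=; first by rewrite big_seq1 /= mul1r step_weight_le.
rewrite big_allpairs_dep /= big_enum /=.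
apply: le_trans (_ : \sum_(v : box d N) step_weight x (box_site v) *
    (step_mass ^+ m * expR (2 * theta * #|I|%:R)) <= _).
  apply: ler_sum => v _; rewrite -mulr_sumr ler_wpM2l ?step_weight_ge0 //.
rewrite -mulr_suml exprS -[leRHS]mulrA ler_wpM2r ?step_weight_sum //.
rewrite mulr_ge0 ?expR_ge0 ?exprn_ge0 // /step_mass.
have /andP[s0 s1] := s01.
by rewrite mulr_ge0 ?exprn_ge0 // addr_ge0 ?expR_ge0 ?invr_ge0 ?ltW.
Qed.

Lemma geometric_le2 (r : R) n : 0 <= r <= 2^-1 -> \sum_(m < n) r ^+ m <= 2.
Proof.
move=> /andP[r0 r1].
suff : \sum_(m < n) r ^+ m <= 2 - 2 * 2^-1 ^+ n.
  by move/le_trans; apply; rewrite gerBl mulr_ge0 // exprn_ge0.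
elim: n => [|n IH]; first by rewrite big_ord0 expr0; lra.
rewrite big_ord_recr /= exprS.
have : r ^+ n <= 2^-1 ^+ n by rewrite lerXn2r // nnegrE; lra.
lra.
Qed.

Variables (e : R) (y : site d) (N : nat).
Hypotheses (e01 : 0 <= e <= 1) (y_ge0 : sle I (origin d) y)
  (y_off : forall i, i \notin I -> y i = 0)
  (rho_le : e * expR 1 * step_mass <= 2^-1).

Local Notation L := ((l1 (origin d) y)%:R : R).

(** One exponential moment serves two purposes: the second summand is the gain, the first charges
    [theta] for each unit lost by restricting to strict chains. *)
Definition excess (A : pred (site d)) : R :=
  theta * ((strict_time I A y)%:R - (ptime A (origin d) y)%:R) +
  (L - (ptime A (origin d) y)%:R).

Lemma drift_origin : (drift I (origin d) y)%:~R = L.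
Proof.
have := l1_decomp I (origin d) y.
have -> : ldesc I (origin d) y = 0%N.
  by have := @desc_monotone _ I (origin d) [::] y; rewrite /= andbT; apply.
have -> : lside I (origin d) y = 0%N.
  by apply: big1 => i; rewrite inE => iI; rewrite y_off // ffunE.
by rewrite mulr0 !addr0 => <-.
Qed.

(** The term of the chain given by [strict_time_chain] is already large enough: each open site
    contributes [expR 1], and [expR (s * L)] restores the drift removed by the tilt. Its sites are
    distinct, so its length is at most the size of the box. *)
Lemma exp_excess_le (w : {ffun box d N -> bool}) :
  expR (excess (config (@box_site d N) w)) <=
  \sum_(m < #|box d N|.+1) \sum_(q <- [seq q <- words (box d N) m | uniq q])
    (expR (s * L) * expR 1 ^+ m * chain_weight (origin d) (map (@box_site d N) q) y)
      * (all w q)%:R.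
Proof.
set A := config _ w; set o := origin d.
have [q [uq Aq hS hT]] := strict_time_chain A y_ge0.
have [q0 q0E] : exists q0 : seq (box d N), q = map (@box_site d N) q0.
  elim: q Aq {uq hS hT} => [|a q IH] /=; first by exists [::].
  move=> /andP[/existsP[v /andP[/eqP <- _]] /IH[q0 ->]].
  by exists (v :: q0).
have uq0 : uniq q0 by move: uq; rewrite q0E => /map_uniq.
have wq0 : all w q0.
  apply/allP => v vq0; rewrite -(configE w v (@box_site_inj d N)).
  by apply: (allP Aq); rewrite q0E map_f.
have szq : size q0 = size q by rewrite q0E size_map.
have sz : (size q0 < #|box d N|.+1)%N by rewrite ltnS -(card_uniqP uq0) max_card.
rewrite (bigD1 (Ordinal sz)) //= ler_wpDr //.
  apply: sumr_ge0 => m _; rewrite sumr_ge0 // => r _.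
  by rewrite !mulr_ge0 ?expR_ge0 ?exprn_ge0 ?expR_ge0 ?chain_weight_ge0.
rewrite (big_rem q0) /=; last by rewrite mem_filter uq0 mem_words.
rewrite ler_wpDr //.
  rewrite sumr_ge0 // => r _.
  by rewrite !mulr_ge0 ?expR_ge0 ?exprn_ge0 ?expR_ge0 ?chain_weight_ge0.
rewrite wq0 mulr1 -q0E.
apply: le_trans (_ : expR (s * L) * expR 1 ^+ size q0 *
   expR (2 * theta * (stalls I o q y)%:R + (1 - s) * (drift I o y)%:~R - (chlen o q y)%:R) <= _); last first.
  by rewrite ler_wpM2l ?exp_chain_le // mulr_ge0 ?expR_ge0 // exprn_ge0 ?expR_ge0.
rewrite -expRM_natr -!expRD ler_expR /excess drift_origin mul1r szq.
have h1 : (strict_time I A y)%:R - (ptime A o y)%:R <= 2 * (stalls I o q y)%:R :> R.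
  by rewrite lerBlDl -natrM -natrD ler_nat.
have h2 : (chlen o q y)%:R <= (size q)%:R + (ptime A o y)%:R :> R by rewrite -natrD ler_nat.
have := ler_wpM2l theta0 h1; rewrite -/o; lra.
Qed.

(** A chain of m distinct sites is open with probability [e ^+ m]; by [rho_le] the sum over m is
    geometric of ratio at most 1/2, hence the factor 2. *)
Lemma expect_exp_excess : expect e (fun w => expR (excess (config (@box_site d N) w))) <=
  2 * expR (s * L + 2 * theta * #|I|%:R).
Proof.
apply: le_trans (expect_le e01 exp_excess_le) _.
have -> : expect e (fun w => \sum_(m < #|box d N|.+1) \sum_(q <- [seq q <- words (box d N) m | uniq q])
    (expR (s * L) * expR 1 ^+ m * chain_weight (origin d) (map (@box_site d N) q) y)
      * (all w q)%:R) =
  \sum_(m < #|box d N|.+1) \sum_(q <- [seq q <- words (box d N) m | uniq q])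
    (expR (s * L) * (e * expR 1) ^+ m * chain_weight (origin d) (map (@box_site d N) q) y).
  rewrite expect_sum; apply: eq_bigr => m _; rewrite expect_sum; apply: eq_big_seq => q.
  rewrite mem_filter => /andP[uq /size_words sq].
  by rewrite expect_scale expect_all // sq exprMn; ring.
apply: le_trans (_ : \sum_(m < #|box d N|.+1)
   expR (s * L + 2 * theta * #|I|%:R) * (e * expR 1 * step_mass) ^+ m <= _).
  apply: ler_sum => m _; rewrite -mulr_sumr.
  have e1 : 0 <= e * expR 1 by have /andP[e0 _] := e01; rewrite mulr_ge0 ?expR_ge0.
  apply: le_trans (_ : expR (s * L) * (e * expR 1) ^+ m *
     (step_mass ^+ m * expR (2 * theta * #|I|%:R)) <= _).
    rewrite ler_wpM2l ?mulr_ge0 ?expR_ge0 ?exprn_ge0 //.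
    apply: le_trans (chain_weight_sum N m (origin d) y).
    rewrite big_filter [leRHS](bigID (fun q : seq (box d N) => uniq q)) /= ler_wpDr //.
    by apply: sumr_ge0 => q _; apply: chain_weight_ge0.
  by rewrite expRD [X in _ <= _ * X]exprMn; lra.
rewrite -mulr_sumr [leRHS]mulrC ler_wpM2l ?expR_ge0 // geometric_le2 // rho_le andbT.
have /andP[e0 _] := e01; have /andP[s0 _] := s01.
by rewrite !mulr_ge0 ?expR_ge0 // exprn_ge0 // addr_ge0 ?expR_ge0 ?invr_ge0 ?ltW.
Qed.

Lemma expect_excess : expect e (fun w => excess (config (@box_site d N) w)) <=
  s * L + 2 * theta * #|I|%:R + 1.
Proof.
(* Jensen by a tangent line: [1 + x <= expR x] at x = excess - M. The [+ 1] in [M] absorbs the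
   factor 2, because [2 <= expR 1]. *)
set M := s * L + 2 * theta * #|I|%:R + 1.
apply: le_trans (_ : expect e (fun w => (M - 1) + expR (- M) * expR (excess (config (@box_site d N) w))) <= _).
  apply: expect_le => // w; rewrite -expRD.
  have := expR_ge1Dx (- M + excess (config (@box_site d N) w)); lra.
rewrite expect_add expect_const expect_scale -lerBrDl opprB [M + _]addrC subrK.
apply: le_trans (_ : expR (- M) * (2 * expR (s * L + 2 * theta * #|I|%:R)) <= _).
  by rewrite ler_wpM2l ?expR_ge0 // expect_exp_excess.
have -> : expR (s * L + 2 * theta * #|I|%:R) = expR M * (expR 1)^-1.
  by rewrite -expRN -expRD /M addrK.
have M0 : expR M != 0 by rewrite gt_eqF ?expR_gt0.
rewrite expRN mulrCA mulKf // -ler_pdivlMr ?invr_gt0 ?expR_gt0 //.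
by rewrite invrK mul1r expR1_ge2.
Qed.

End FirstMoment.

(** * Coarse-graining in mean *)

Lemma euclid_unique (k a b : nat) (u v : int) : (a < k)%N -> (b < k)%N ->
  k%:Z * u + a%:Z = k%:Z * v + b%:Z -> u = v /\ a = b.
Proof. by case: (ltgtP u v) => [uv|vu|<-]; nia. Qed.

Section CoarseExpectation.
Variables (R : realType) (d : nat) (I : {set 'I_d}).
Hypothesis I_neq0 : I != finset.set0.
Implicit Types (e delta : R) (y : site d) (k : 'I_d -> nat).

Lemma card_offsets k : #|{dffun forall i : 'I_d, 'I_(k i)}| = (\prod_i k i)%N.
Proof.
rewrite card_dep_ffun foldrE big_map -big_enum /=.
by rewrite big_enum [in RHS]big_enum; apply: eq_bigr => i _; rewrite card_ord.
Qed.

(** Sites are indexed by a box and an offset in it. Lowering the probability that a box is open to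
    [delta] can only lengthen the strict time. *)
Lemma coarse_mean_time k N e delta y :
  (forall i, 0 < k i)%N -> (forall i, i \notin I -> k i = 1%N) ->
  sle I (origin d) y -> 0 <= e <= 1 -> 0 <= delta ->
  delta <= 1 - (1 - e) ^+ (\prod_i k i)%N ->
  mean_time e (dilate k y) + (l1 (origin d) y)%:R <=
  expect delta (fun w => (strict_time I (config (@box_site d N) w) y)%:R) +
    (l1 (origin d) (dilate k y))%:R.
Proof.
move=> k0 k1 hy e01 d0 hd.
pose K : finType := {dffun forall i : 'I_d, 'I_(k i)}.
pose f (p : box d N * K) : site d := [ffun i => (k i)%:Z * box_site p.1 i + (p.2 i)%:Z].
have fi : injective f.
  move=> [u a] [v b] /ffunP h.
  have E i : box_site u i = box_site v i /\ a i = b i.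
    have := h i; rewrite ffunE [RHS]ffunE /=.
    by move=> /(euclid_unique (ltn_ord (a i)) (ltn_ord (b i)))[-> /val_inj ->].
  congr (_, _); first by apply: box_site_inj; apply/ffunP => i; have [] := E i.
  by apply/ffunP => i; have [] := E i.
pose F (w : {ffun box d N -> bool}) : R := (strict_time I (config (@box_site d N) w) y)%:R.
have hF : expect (1 - (1 - e) ^+ #|K|) F <= expect delta F.
  apply: expect_antitone => //; rewrite ?card_offsets //.
    rewrite gerBl exprn_ge0 // subr_ge0; by case/andP: e01.
  move=> w w' ww'; rewrite ler_nat; apply: strict_time_mono => x.
  by case/existsP => v /andP[vx /ww' wv]; apply/existsP; exists v; rewrite vx.
apply: le_trans (lerD hF (lexx _)); rewrite -(expect_or K e F).
apply: le_trans (lerD (mean_time_le_expect e01 (dilate k y) fi) (lexx _)) _.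
rewrite -[X in _ + X <= _](expect_const (box d N * K)%type e) -[X in _ <= _ + X](expect_const (box d N * K)%type e) -!expect_add.
apply: expect_le => // w; rewrite /F -!natrD ler_nat.
apply: coarse_grain => // u /existsP[v /andP[/eqP <-]].
rewrite ffunE => /existsP[c wc]; exists (f (v, c)); first by rewrite configE.
move=> i; have -> : f (v, c) i = (k i)%:Z * box_site v i + (c i)%:Z by rewrite ffunE.
by rewrite lerDl mulrDr mulr1 ltrD2l lez_nat ltz_nat ltn_ord.
Qed.

(** The condition reads 1 <= (1 - delta)(1 + M e), while (1 - e)^M (1 + M e) <= 1 by induction on
    M. *)
Lemma bernoulli_coarse e delta M : 0 <= e <= 1 -> delta <= 1 ->
  delta <= M%:R * e * (1 - delta) -> delta <= 1 - (1 - e) ^+ M.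
Proof.
move=> /andP[e0 e1] d1 h.
have H : (1 - e) ^+ M * (1 + M%:R * e) <= 1.
  elim: M {h} => [|M IH]; first by rewrite expr0 mul0r addr0 mulr1.
  rewrite exprSr; apply: le_trans IH; rewrite -mulrA ler_wpM2l ?exprn_ge0 ?subr_ge0 //.
  rewrite -natr1; have : 0 <= M%:R :> R by [].
  nra.
have p0 : 0 <= (1 - e) ^+ M by rewrite exprn_ge0 // subr_ge0.
have Me : 0 <= M%:R * e by rewrite mulr_ge0.
move: ((1 - e) ^+ M) H p0 => p H p0.
have h1 : (1 - delta) * (1 + M%:R * e) >= 1 by lra.
have h2 : p * (1 + M%:R * e) <= (1 - delta) * (1 + M%:R * e) by lra.
rewrite -subr_ge0; have : p <= 1 - delta; last lra.
rewrite -(ler_pM2r (_ : 0 < 1 + M%:R * e)) //; lra.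
Qed.

Lemma box_time_le_l1 e : 0 <= e <= 1 -> forall N y,
  box_time N e y <= (l1 (origin d) y)%:R.
Proof.
move=> e01 N y; rewrite -[leRHS](expect_const (box d N) e); apply: expect_le => // w.
by rewrite ler_nat ptime_le_l1.
Qed.

Lemma expect_excessE N e theta y :
  expect e (fun w => excess I theta y (config (@box_site d N) w)) =
  theta * (expect e (fun w => (strict_time I (config (@box_site d N) w) y)%:R) - box_time N e y)
    + ((l1 (origin d) y)%:R - box_time N e y).
Proof.
transitivity (expect e (fun w => theta * (strict_time I (config (@box_site d N) w) y)%:R +
   (- (theta + 1) * (ptime (config (@box_site d N) w) (origin d) y)%:R + (l1 (origin d) y)%:R))).
  by congr (expect e _); apply/funext => w; rewrite /excess; ring.
by rewrite !expect_add !expect_scale expect_const /box_time; ring.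
Qed.

(** [coarse_mean_time] involves the strict time at [delta]; [expect_excess] compares it with the
    passage time, since the gain part of the excess is nonnegative and [theta * (S - T)] alone obeys
    the bound. *)
Lemma mean_time_master k e delta s theta y :
  (forall i, 0 < k i)%N -> (forall i, i \notin I -> k i = 1%N) ->
  sle I (origin d) y -> (forall i, i \notin I -> y i = 0) ->
  0 <= e <= 1 -> 0 <= delta <= 1 ->
  delta <= (\prod_i k i)%N%:R * e * (1 - delta) ->
  0 < s <= 1 -> 0 < theta -> delta * expR 1 * step_mass I s theta <= 2^-1 ->
  (l1 (origin d) y)%:R - mean_time delta y
    - (s * (l1 (origin d) y)%:R + 2 * theta * #|I|%:R + 1) / theta
  <= (l1 (origin d) (dilate k y))%:R - mean_time e (dilate k y).
Proof.
move=> k0 k1 hy yoff e01 d01 hd s01 th0 rho.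
rewrite lerBlDr -lerBlDl opprB; set c := (_ / theta).
suff : (l1 (origin d) y)%:R - ((l1 (origin d) (dilate k y))%:R - mean_time e (dilate k y)) - c
    <= mean_time delta y by lra.
apply: mean_time_ge => N.
have d0 : 0 <= delta by case/andP: d01.
have d1 : delta <= 1 by case/andP: d01.
have := coarse_mean_time N k0 k1 hy e01 d0 (bernoulli_coarse e01 d1 hd).
have := @expect_excess R d I s theta s01 (ltW th0) delta y N d01 hy yoff rho.
have := box_time_le_l1 d01 N y.
rewrite expect_excessE; set S := expect delta _; set T := box_time N delta y.
set L := (l1 (origin d) y)%:R => TL h hS.
have {h} : theta * (S - T) <= c * theta by rewrite /c divfK ?gt_eqF //; lra.
rewrite [c * _]mulrC ler_pM2l //; lra.
Qed.

Lemma mean_time_lower delta s y : sle I (origin d) y -> (forall i, i \notin I -> y i = 0) ->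
  0 <= delta <= 1 -> 0 < s <= 1 -> delta * expR 1 * step_mass I s 0 <= 2^-1 ->
  (l1 (origin d) y)%:R - mean_time delta y <= s * (l1 (origin d) y)%:R + 1.
Proof.
move=> hy yoff d01 s01 rho; rewrite lerBlDl -lerBlDr; apply: mean_time_ge => N.
have := @expect_excess R d I s 0 s01 (lexx _) delta y N d01 hy yoff rho.
by rewrite expect_excessE; lra.
Qed.

Definition unit_site : site d := [ffun i => (i \in I)%:Z].

Lemma unit_site_ge0 : sle I (origin d) unit_site.
Proof. by apply/forall_inP => i iI; rewrite !ffunE iI. Qed.

(** The source of the positivity of the constant: the box at the origin is open with probability at
    least 1/2, and then the chain reduced to the origin saves one step. *)
Lemma mean_time_unit k e : (forall i, 0 < k i)%N -> (forall i, i \notin I -> k i = 1%N) ->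
  0 <= e <= 1 -> 1 <= (\prod_i k i)%N%:R * e ->
  mean_time e (dilate k unit_site) <= (l1 (origin d) (dilate k unit_site))%:R - 2^-1.
Proof.
move=> k0 k1 e01 h.
have hd : (2^-1 : R) <= 1 - (1 - e) ^+ (\prod_i k i)%N.
  by apply: bernoulli_coarse => //; lra.
have := coarse_mean_time 0 k0 k1 unit_site_ge0 e01 _ hd.
have d01 : 0 <= (2^-1 : R) <= 1 by lra.
move=> /(_ (proj1 (andP d01))).
pose v0 : box d 0 := [ffun=> ord0].
have v0E : box_site v0 = origin d by apply/ffunP => i; rewrite !ffunE.
have : expect 2^-1 (fun w => (strict_time I (config (@box_site d 0) w) unit_site)%:R) <=
    (l1 (origin d) unit_site)%:R - 2^-1 :> R.
  apply: le_trans (_ : expect 2^-1 (fun w : {ffun box d 0 -> bool} =>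
      (l1 (origin d) unit_site)%:R + (- 1) * (all w [:: v0])%:R) <= _).
    apply: expect_le => // w; rewrite /= andbT.
    case wv: (w v0); last by rewrite mulr0 addr0 ler_nat strict_time_le_l1.
    have l0 : (0 < l1 (origin d) unit_site)%N.
      have /set0Pn[i iI] := I_neq0; rewrite /l1 (bigD1 i) //= !ffunE iI; lia.
    rewrite mulr1 -lerBlDr opprK natr1 ler_nat.
    suff : (strict_time I (config (@box_site d 0) w) unit_site <= (l1 (origin d) unit_site).-1)%N by lia.
    apply: (@strict_time_le _ _ _ _ [:: origin d]); last by rewrite /= l1xx; lia.
    rewrite /strict_chain /= -{1}v0E configE ?wv /=; last exact: box_site_inj.
    apply/and3P; split => //; first by rewrite andbT; apply/forall_inP.
    by apply/forall_inP => i iI; rewrite !ffunE iI.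
  by rewrite expect_add expect_const expect_scale expect_all //= expr1; lra.
lra.
Qed.

End CoarseExpectation.

(** * The time constant *)

Section Averages.
Variable R : realType.
Implicit Types (u v : nat -> R) (c l : R).

Lemma cvg_const_over c : (fun n => c / n%:R) @ \oo --> (0 : R).
Proof.
apply/cvgrPdist_le => eps eps0.
near=> n; rewrite sub0r normrN normrM normfV [`|n%:R|]ger0_norm //.
have n0 : 0 < n%:R :> R by rewrite ltr0n; near: n; apply: nbhs_infty_gt.
rewrite ler_pdivrMr // mulrC -ler_pdivrMr //; apply: ltW.
apply: lt_le_trans (truncnS_gt _) _; rewrite ler_nat; near: n; exact: nbhs_infty_ge.
Unshelve. all: by end_near. Qed.

Lemma cvg_over_near u v c l : (forall n, `|u n - v n| <= c) ->
  (fun n => u n / n%:R) @ \oo --> l -> (fun n => v n / n%:R) @ \oo --> l.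
Proof.
move=> huv hu.
have h0 : (fun n => (v n - u n) / n%:R) @ \oo --> (0 : R).
  apply: (@squeeze_cvgr _ _ _ _ (fun n => - (c / n%:R)) (fun n => c / n%:R)).
  - apply: nearW => n; rewrite -ler_norml normrM normfV [`|n%:R|]ger0_norm //.
    by rewrite ler_wpM2r ?invr_ge0 // distrC.
  - by rewrite -oppr0; apply: cvgN; apply: cvg_const_over.
  - exact: cvg_const_over.
have -> : (fun n => v n / n%:R) = (fun n => u n / n%:R) + (fun n => (v n - u n) / n%:R).
  by apply/funext => n; rewrite /= !fctE -mulrDl addrC subrK.
by rewrite -[l]addr0; apply: cvgD.
Qed.

Lemma cvg_subseq_muln u l m : (0 < m)%N -> u @ \oo --> l ->
  (fun n => u (m * n)%N) @ \oo --> l.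
Proof.
move=> m0 /cvgrPdist_le hu; apply/cvgrPdist_le => eps /hu[N _ hN].
exists N => // n /= Nn; apply: hN => /=.
by apply: leq_trans Nn _; rewrite leq_pmull.
Qed.

Lemma ler_cvgn u v l l' : u @ \oo --> l -> v @ \oo --> l' ->
  (forall n, u n <= v n) -> l <= l'.
Proof. by move=> hu hv uv; apply: ler_cvg_to hu hv _; apply: nearW. Qed.

(** The error [c] allows for integer parts, which are additive only up to a bounded amount; [u + c]
    is subadditive, and its quotients tend to their infimum. *)
Lemma fekete u c : (forall n, 0 <= u n) -> 0 <= c ->
  (forall m n, u (m + n)%N <= u m + u n + c) ->
  cvgn (fun n => u n / n%:R).
Proof.
move=> u0 c0 sub.
pose v n := u n + c.
have v0 n : 0 <= v n by rewrite addr_ge0.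
have vsub m n : v (m + n)%N <= v m + v n by rewrite /v; have := sub m n; lra.
have vmul q m b : v (q * m + b)%N <= q%:R * v m + v b.
  elim: q => [|q IH]; first by rewrite mul0n add0n mul0r add0r.
  by rewrite mulSn -addnA -natr1; have := vsub m (q * m + b)%N; lra.
have vlin b : v b <= v 0%N + b%:R * v 1%N.
  by have := vmul b 1%N 0%N; rewrite muln1 addn0 addrC.
pose S := [set v n / n%:R | n in [set n | (0 < n)%N]].
have iS : has_inf S.
  split; first by exists (v 1%N / 1%:R), 1%N.
  by exists 0 => _ [n _ <-]; rewrite divr_ge0.
suff H : (fun n => v n / n%:R) @ \oo --> inf S.
  apply/cvg_ex; exists (inf S); apply: cvg_over_near H => n.
  by rewrite /v addrC addKr ger0_norm.
apply/cvgrPdist_le => eps eps0.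
have e2 : 0 < eps / 2 by rewrite divr_gt0.
have [_ [m /= m0 <-] hm] := inf_adherent e2 iS.
have := cvg_const_over (v 0%N + m%:R * v 1%N) => /cvgrPdist_le/(_ _ e2) hc.
near=> n.
have n0 : (0 < n)%N by near: n; apply: nbhs_infty_gt.
have n0' : 0 < n%:R :> R by rewrite ltr0n.
have m0' : 0 < m%:R :> R by rewrite ltr0n.
have lo : inf S <= v n / n%:R by apply: ge_inf; [case: iS|exists n].
rewrite distrC ger0_norm ?subr_ge0 // lerBlDr.
have hcn : `|0 - (v 0%N + m%:R * v 1%N) / n%:R| <= eps / 2 by near: n.
rewrite sub0r normrN ger0_norm in hcn; last by rewrite divr_ge0 // addr_ge0 // mulr_ge0.
have h1 : v n <= (n %/ m)%N%:R * v m + (v 0%N + m%:R * v 1%N).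
  rewrite {1}(divn_eq n m); apply: le_trans (vmul _ _ _) _; rewrite lerD2l.
  apply: le_trans (vlin _) _; rewrite lerD2l ler_wpM2r // ler_nat ltnW // ltn_mod //.
have h2 : (n %/ m)%N%:R * v m <= n%:R * (v m / m%:R).
  rewrite mulrA ler_pdivlMr // mulrAC ler_wpM2r // -natrM ler_nat leq_divM //.
have h3 : v n / n%:R <= v m / m%:R + (v 0%N + m%:R * v 1%N) / n%:R.
  rewrite ler_pdivrMr // mulrDl divfK ?gt_eqF // [_ * n%:R]mulrC; lra.
lra.
Unshelve. all: by end_near. Qed.

End Averages.

Section TimeConstant.
Variables (R : realType) (d : nat).
Implicit Types (z w : 'I_d -> R) (e : R).

Definition scaled z (n : nat) : site d := floor_site (fun i => n%:R * z i).

Definition mu e z : R := limn (fun n => mean_time e (scaled z n) / n%:R).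

Lemma l1_le_dim (x y : site d) : (forall i, `|x i - y i| <= 1) -> (l1 x y <= d)%N.
Proof.
move=> h; rewrite -[leqRHS]card_ord -sum1_card; apply: leq_sum => i _.
by have := h i; lia.
Qed.

Lemma mean_time_dist e (x y : site d) : 0 <= e <= 1 ->
  `|mean_time e x - mean_time e y| <= (l1 x y)%:R.
Proof.
move=> e01; rewrite ler_norml; apply/andP; split.
  by have := mean_time_lip e01 y x; lra.
by have := mean_time_lip e01 x y; rewrite l1C; lra.
Qed.

Lemma floor_bounds (x : R) : (Num.floor x)%:~R <= x < (Num.floor x)%:~R + 1.
Proof. by rewrite floor_le /=; have := floorD1_gt x; rewrite intrD. Qed.

Lemma dist_int_le1 (m n : int) : -2 < (m%:~R - n%:~R : R) < 2 -> `|m - n| <= 1.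
Proof.
rewrite -intrB => /andP[h1 h2].
have : (-2 < m - n)%R by rewrite -(ltr_int R) mulrNz.
have : (m - n < 2)%R by rewrite -(ltr_int R).
lia.
Qed.

Section Fixed.
Variables (e : R) (e01 : 0 <= e <= 1).

Lemma mu_cvg z : (fun n => mean_time e (scaled z n) / n%:R) @ \oo --> mu e z.
Proof.
apply: (@fekete _ _ d%:R) => // [n|m n]; first exact: mean_time_ge0.
apply: le_trans (mean_time_lip e01 _ (scaled z m + scaled z n)) _.
apply: lerD; first exact: mean_time_subadd.
rewrite ler_nat; apply: l1_le_dim => i; rewrite !ffunE; apply: dist_int_le1.
rewrite intrD natrD mulrDl.
have := floor_bounds (m%:R * z i); have := floor_bounds (n%:R * z i).
have := floor_bounds (m%:R * z i + n%:R * z i); lra.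
Qed.

Lemma l1_scaled_cvg z :
  (fun n => (l1 (origin d) (scaled z n))%:R / n%:R : R) @ \oo --> norm1 z.
Proof.
apply: (@cvg_over_near _ (fun n => n%:R * norm1 z) _ d%:R).
  move=> n; rewrite /l1 /norm1 natr_sum mulr_sumr -sumrB.
  apply: le_trans (ler_norm_sum _ _ _) _.
  rewrite -[X in _ <= X%:R](card_ord d) -sum1_card natr_sum; apply: ler_sum => i _.
  rewrite !ffunE sub0r abszN natr_absz intr_norm.
  have := floor_bounds (n%:R * z i); rewrite -[n%:R in X in X -> _]ger0_norm //.
  rewrite -[n%:R in X in _ -> X]ger0_norm // -normrM => h.
  apply: le_trans (ler_dist_dist _ _) _; rewrite ler_norml.
  by move: h; rewrite normr_nat; lra.
apply: cvg_near_cst; near=> n; rewrite mulrAC mulfV ?mul1r // pnatr_eq0 -lt0n.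
by near: n; apply: nbhs_infty_gt.
Unshelve. all: by end_near. Qed.

Lemma mu_le_norm1 z : mu e z <= norm1 z.
Proof.
apply: (ler_cvgn (@mu_cvg z) (@l1_scaled_cvg z)) => n.
by rewrite ler_wpM2r ?invr_ge0 // mean_time_le_l1.
Qed.

Lemma mu_eq z w c : (forall n, `|mean_time e (scaled z n) - mean_time e (scaled w n)| <= c) ->
  mu e z = mu e w.
Proof.
move=> h; apply/esym/cvg_lim => //; exact: (@cvg_over_near R (fun n => mean_time e (scaled z n)) _ c _ h (@mu_cvg z)).
Qed.

Lemma mu_reindex z (p q : 'I_d -> 'I_d) : cancel p q -> cancel q p ->
  mu e (z \o p) = mu e z.
Proof.
move=> pq qp; apply: (@mu_eq _ _ 0) => n; rewrite normr_le0 subr_eq0; apply/eqP.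
pose f (t : 'I_d -> 'I_d) (x : site d) : site d := [ffun i => x (t i)].
have fK s t : cancel s t -> cancel (f t) (f s).
  by move=> st x; apply/ffunP => i; rewrite !ffunE st.
have fn t u v : injective t -> neighbor u v -> neighbor (f t u) (f t v).
  move=> ti; rewrite /neighbor (reindex_inj ti) => /eqP <-; apply/eqP.
  by apply: eq_bigr => i _; rewrite !ffunE.
have f0 t : f t (origin d) = origin d by apply/ffunP => i; rewrite !ffunE.
have -> : scaled (z \o p) n = f p (scaled z n) by apply/ffunP => i; rewrite !ffunE.
apply/le_anti/andP; split.
  apply: mean_time_map => //; last exact: can_inj (fK _ _ qp).
  by move=> u v; apply: fn; apply: can_inj pq.
rewrite -{1}[scaled z n](fK _ _ qp).
apply: mean_time_map => //; last exact: can_inj (fK _ _ pq).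
by move=> u v; apply: fn; apply: can_inj qp.
Qed.

(** Reflections are symmetries but do not commute with integer parts; the endpoints differ by at
    most 1 in each coordinate, which disappears in the limit. *)
Lemma mu_abs z : mu e (fun i => `|z i|) = mu e z.
Proof.
pose f (x : site d) : site d := [ffun i => if 0 <= z i then x i else - x i].
have fK : involutive f.
  by move=> x; apply/ffunP => i; rewrite !ffunE; case: (0 <= z i) => //; rewrite opprK.
have fn u v : neighbor u v -> neighbor (f u) (f v).
  rewrite /neighbor => /eqP <-; apply/eqP; apply: eq_bigr => i _; rewrite !ffunE.
  by case: ifP => // _; ring.
have f0 : f (origin d) = origin d.
  by apply/ffunP => i; rewrite !ffunE oppr0; case: ifP.
have fE y : mean_time e (f y) = mean_time e y.
  apply/le_anti/andP; split; first by apply: mean_time_map => //; apply: inv_inj.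
  by rewrite -{1}[y]fK; apply: mean_time_map => //; apply: inv_inj.
apply: (@mu_eq _ _ d%:R) => n; rewrite -[X in _ - X]fE.
apply: le_trans (mean_time_dist _ _ e01) _; rewrite ler_nat.
apply: l1_le_dim => i; rewrite !ffunE; case: (leP 0 (z i)) => zi.
  by rewrite (ger0_norm zi) subrr.
rewrite (ltr0_norm zi); apply: dist_int_le1; rewrite mulrNz.
have := floor_bounds (n%:R * z i); have := floor_bounds (n%:R * - z i); lra.
Qed.

(** Each unit step away from the origin adds 1 to the norm and at most 1 to the mean time. *)
Lemma gain_mono (x y : site d) : (forall i, 0 <= x i <= y i) ->
  (l1 (origin d) x)%:R - mean_time e x <= (l1 (origin d) y)%:R - mean_time e y.
Proof.
move=> h; have -> : l1 (origin d) y = (l1 (origin d) x + l1 x y)%N.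
  by rewrite /l1 -big_split /=; apply: eq_bigr => i _; have := h i; rewrite !ffunE; lia.
by have := mean_time_lip e01 y x; rewrite natrD; lra.
Qed.

Definition gain z : R := norm1 z - mu e z.

Lemma gain_ge0 z : 0 <= gain z.
Proof. by rewrite subr_ge0 mu_le_norm1. Qed.

Lemma gain_cvg z : (fun n => ((l1 (origin d) (scaled z n))%:R - mean_time e (scaled z n)) / n%:R)
  @ \oo --> gain z.
Proof.
have -> : (fun n => ((l1 (origin d) (scaled z n))%:R - mean_time e (scaled z n)) / n%:R) =
  (fun n => (l1 (origin d) (scaled z n))%:R / n%:R : R) - (fun n => mean_time e (scaled z n) / n%:R).
  by apply/funext => n; rewrite /= !fctE mulrBl.
by apply: cvgB; [apply: l1_scaled_cvg|apply: mu_cvg].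
Qed.

End Fixed.

Variable I : {set 'I_d}.
Hypothesis I_neq0 : I != finset.set0.

Definition supported z := forall i, if i \in I then (0 < z i : Prop) else z i = 0.

Lemma supported_ge0 z i : supported z -> 0 <= z i.
Proof. by move=> /(_ i); case: ifP => _ // => [/ltW|->]. Qed.

Lemma scaled_ge0 z n i : supported z -> 0 <= scaled z n i.
Proof. by move=> hz; rewrite ffunE floor_ge0 mulr_ge0 // supported_ge0. Qed.

Lemma scaled_sle z n : supported z -> sle I (origin d) (scaled z n).
Proof. by move=> hz; apply/forall_inP => i iI; rewrite ffunE scaled_ge0. Qed.

Lemma scaled_off z n i : supported z -> i \notin I -> scaled z n i = 0.
Proof. by move=> hz iI; rewrite ffunE; have := hz i; rewrite (negbTE iI) => ->; rewrite mulr0 floor0. Qed.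

(** [mean_time_master] at [scaled w n], divided by [n]. The dilated target lies below
    [scaled z (lam * n)], so [gain_mono] applies; of the error only the part proportional to the
    distance survives. *)
Lemma gain_master z w (lam : nat) (k : 'I_d -> nat) e delta s theta :
  supported z -> supported w -> (0 < lam)%N ->
  (forall i, 0 < k i)%N -> (forall i, i \notin I -> k i = 1%N) ->
  (forall i, (k i)%:R * w i <= lam%:R * z i) ->
  0 <= e <= 1 -> 0 <= delta <= 1 ->
  delta <= (\prod_i k i)%N%:R * e * (1 - delta) ->
  0 < s <= 1 -> 0 < theta -> delta * expR 1 * step_mass I s theta <= 2^-1 ->
  gain delta w - s * norm1 w / theta <= lam%:R * gain e z.
Proof.
move=> hz hw lam0 k0 k1 kw e01 d01 hd s01 th0 rho.
pose c := (2 * theta * #|I|%:R + 1) / theta.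
pose L n : R := (l1 (origin d) (scaled w n))%:R.
have c1 : (fun n => (L n - mean_time delta (scaled w n)) / n%:R - (s / theta) * (L n / n%:R) - c / n%:R)
    @ \oo --> gain delta w - s * norm1 w / theta - 0.
  rewrite [s * _ / _]mulrAC; apply: cvgB; last exact: cvg_const_over.
  apply: cvgB; first exact: gain_cvg.
  by apply: cvgMl_tmp; apply: l1_scaled_cvg.
rewrite subr0 in c1.
have c2 := @cvgMl_tmp R nat \oo _ _ lam%:R _ (cvg_subseq_muln lam0 (@gain_cvg e e01 z)).
apply: (ler_cvgn c1 (c2 _)) => n.
have := mean_time_master I_neq0 k0 k1 (scaled_sle n hw) (fun i iI => scaled_off n hw iI)
   e01 d01 hd s01 th0 rho.
have : (l1 (origin d) (dilate k (scaled w n)))%:R - mean_time e (dilate k (scaled w n)) <=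
    (l1 (origin d) (scaled z (lam * n)))%:R - mean_time e (scaled z (lam * n)).
  apply: gain_mono => // i; rewrite ffunE mulr_ge0 ?scaled_ge0 //=.
  rewrite !ffunE floor_ge_int intrM natrM mulrAC.
  apply: le_trans (_ : (k i)%:R * (n%:R * w i) <= _); first by rewrite ler_wpM2l ?floor_le.
  by rewrite mulrCA mulrC ler_wpM2r.
move=> h1 h2; have {h1 h2} h := le_trans h2 h1.
have -> : lam%:R * (((l1 (origin d) (scaled z (lam * n)))%:R - mean_time e (scaled z (lam * n))) / (lam * n)%N%:R)
   = ((l1 (origin d) (scaled z (lam * n)))%:R - mean_time e (scaled z (lam * n))) / n%:R.
  by rewrite natrM invfM mulrCA mulVKf // pnatr_eq0 -lt0n.
have -> : (L n - mean_time delta (scaled w n)) / n%:R - (s / theta) * (L n / n%:R) - c / n%:R =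
    (L n - mean_time delta (scaled w n) - (s * L n + 2 * theta * #|I|%:R + 1) / theta) / n%:R.
  by rewrite /c; ring.
by rewrite ler_wpM2r ?invr_ge0.
Qed.

Lemma gain_upper w delta s : supported w -> 0 <= delta <= 1 -> 0 < s <= 1 ->
  delta * expR 1 * step_mass I s 0 <= 2^-1 -> gain delta w <= s * norm1 w.
Proof.
move=> hw d01 s01 rho; pose L n : R := (l1 (origin d) (scaled w n))%:R.
have c1 := @gain_cvg delta d01 w.
have c2 : (fun n => s * (L n / n%:R) + 1 / n%:R) @ \oo --> s * norm1 w + 0.
  by apply: cvgD; [apply: cvgMl_tmp; apply: l1_scaled_cvg|apply: cvg_const_over].
rewrite addr0 in c2; apply: (ler_cvgn c1 c2) => n; rewrite mulrA -mulrDl.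
rewrite ler_wpM2r ?invr_ge0 //.
exact: mean_time_lower (scaled_sle n hw) (fun i iI => scaled_off n hw iI) d01 s01 rho.
Qed.

Definition unit_vec : 'I_d -> R := fun i => (i \in I)%:R.

Lemma unit_vec_supported : supported unit_vec.
Proof. by move=> i; rewrite /unit_vec; case: (i \in I) => //; apply: ltr01. Qed.

Lemma norm1_unit : norm1 unit_vec = #|I|%:R.
Proof.
rewrite /norm1 -sum1_card natr_sum big_mkcond [RHS]big_mkcond /=.
by apply: eq_bigr => i _; rewrite /unit_vec; case: ifP; rewrite ?normr1 ?normr0.
Qed.

(** With boxes of side [m] in the directions of [I], [mean_time_unit] gains 1/2 on the way to [D];
    subadditivity repeats this along the multiples of [D], which are exactly the sites
    [scaled unit_vec (m * n)]. *)
Lemma gain_unit (m : nat) e : (0 < m)%N -> 0 <= e <= 1 -> 1 <= m%:R ^+ #|I| * e ->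
  (2 * m%:R)^-1 <= gain e unit_vec.
Proof.
move=> m0 e01 he; pose k (i : 'I_d) := if i \in I then m else 1%N.
have k0 i : (0 < k i)%N by rewrite /k; case: ifP.
have k1 i : i \notin I -> k i = 1%N by rewrite /k => /negbTE ->.
have kE : (\prod_i k i)%N%:R = m%:R ^+ #|I| :> R.
  by rewrite natr_prod -prodr_const [RHS]big_mkcond; apply: eq_bigr => i _; rewrite /k; case: ifP.
have hu : 1 <= (\prod_i k i)%N%:R * e by rewrite kE.
pose D := dilate k (unit_site I).
have hD := mean_time_unit I_neq0 k0 k1 e01 hu; rewrite -/D in hD.
have LD : l1 (origin d) D = (m * #|I|)%N.
  rewrite /l1 mulnC -sum_nat_const [RHS]big_mkcond; apply: eq_bigr => i _.
  by rewrite !ffunE /k; case: ifP => iI; rewrite ?mulr0 ?mulr1 //; lia.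
have DE n : scaled unit_vec (m * n) = D *+ n.
  apply/ffunP => i; rewrite ffunMnE !ffunE /unit_vec /k.
  case: ifP => iI; rewrite ?mulr0 ?mulr1 ?floor0 ?mul0rn //.
  by rewrite -[(m * n)%N%:R]/((m * n)%N%:~R) intrKfloor; lia.
have sub n : mean_time e (D *+ n) <= n%:R * mean_time e D.
  elim: n => [|n IH]; first by rewrite mulr0n mul0r (_ : 0 = origin d) ?mean_time_origin //; apply/ffunP => i; rewrite !ffunE.
  rewrite mulrS -natr1 mulrDl mul1r addrC; apply: le_trans (mean_time_subadd e01 _ _) _.
  by rewrite lerD2r.
have m0' : 0 < m%:R :> R by rewrite ltr0n.
have c1 := cvg_subseq_muln m0 (@mu_cvg e e01 unit_vec).
have c2 : (fun n => mean_time e D / m%:R * (n%:R / n%:R)) @ \oo --> mean_time e D / m%:R * 1.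
  apply: cvgMl_tmp; apply: cvg_near_cst; near=> n; rewrite divff // pnatr_eq0 -lt0n.
  by near: n; apply: nbhs_infty_gt.
have h : mu e unit_vec <= mean_time e D / m%:R.
  rewrite -[leRHS]mulr1; apply: (ler_cvgn c1 c2) => n; rewrite DE natrM invfM.
  apply: le_trans (ler_wpM2r _ (sub n)) _; first by rewrite mulr_ge0 ?invr_ge0.
  by rewrite le_eqVlt; apply/orP; left; apply/eqP; ring.
rewrite /gain norm1_unit.
have : mean_time e D / m%:R <= #|I|%:R - (2 * m%:R)^-1.
  have e2 : (2 * m%:R)^-1 * m%:R = 2^-1 :> R by rewrite invfM divfK // gt_eqF.
  by rewrite ler_pdivrMr // mulrBl e2; move: hD; rewrite LD natrM; lra.
lra.
Unshelve. all: by end_near. Qed.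

End TimeConstant.

(** * Small parameters *)

Section SmallEpsilon.
Variables (R : realType) (d : nat) (I : {set 'I_d}).
Hypothesis I_neq0 : I != finset.set0.
Implicit Types (z w : 'I_d -> R) (e delta eta theta : R).

Local Notation a := #|I|.

Lemma card_support_gt0 : (0 < a)%N. Proof. by rewrite card_gt0. Qed.

Definition rate e : R := e `^ a%:R^-1.

Lemma rate_gt0 e : 0 < e -> 0 < rate e.
Proof. exact: powR_gt0. Qed.

Lemma root_powR (x : R) : 0 <= x -> (x `^ a%:R^-1) ^+ a = x.
Proof.
move=> x0; rewrite -powR_mulrn ?powR_ge0 // -powRrM mulVf ?powRr1 //.
by rewrite pnatr_eq0 -lt0n card_support_gt0.
Qed.

Lemma rate_expr e : 0 < e -> rate e ^+ a = e.
Proof. by move=> e0; apply: root_powR; apply: ltW. Qed.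

Lemma rate_lt e (x : R) : 0 < e -> 0 < x -> e < x ^+ a -> rate e < x.
Proof.
move=> e0 x0 ex; rewrite ltNge; apply: contraL ex => xr.
rewrite -leNgt -[leRHS](rate_expr e0).
by apply: lerXn2r => //; rewrite nnegrE ltW ?rate_gt0.
Qed.

Definition gmean z : R := \prod_(i in I) (z i) `^ a%:R^-1.

Lemma gmean_gt0 z : supported I z -> 0 < gmean z.
Proof.
move=> hz; apply: prodr_gt0 => i iI; apply: powR_gt0.
by have := hz i; rewrite iI.
Qed.

Lemma gmean_expr z : supported I z -> gmean z ^+ a = \prod_(i in I) z i.
Proof.
move=> hz; rewrite -prodrXl; apply: eq_bigr => i iI; rewrite root_powR //.
exact: supported_ge0 hz.
Qed.

Lemma norm1_gt0 z : supported I z -> 0 < norm1 z.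
Proof.
move=> hz; have /set0Pn[i iI] := I_neq0.
rewrite /norm1 (bigD1 i) //= ltr_pwDl //; last by apply: sumr_ge0.
by have := hz i; rewrite iI normr_gt0 => h; apply: lt0r_neq0.
Qed.

(** Chosen for s = tilt [rate delta]: the mass of a step is then at most (2 / s)^a times the
    sideways factor, delta is (rate delta)^a, and delta times [expR 1] times the mass comes out at
    most 1/2. *)
Definition tilt : R := 4 * expR 1 * 4 ^+ #|~: I|.

Lemma tilt_ge2 : 2 <= tilt.
Proof.
have e2 := expR1_ge2 R; have : 1 <= 4 ^+ #|~: I| :> R by apply: exprn_ege1; lra.
rewrite /tilt; set X := 4 ^+ _ => hX; nra.
Qed.

(** The last hypothesis puts [expR (2 * theta + 1)] below [s^-1]: stalled moves, bonus included,
    weigh no more than forward ones. For fixed [theta] it holds as soon as [delta] is small. *)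
Lemma small_params theta delta : 0 <= theta -> 0 < delta ->
  expR (2 * theta + 1) * (tilt * rate delta) <= 1 ->
  0 < tilt * rate delta <= 1 /\
  delta * expR 1 * step_mass I (tilt * rate delta) theta <= 2^-1.
Proof.
move=> th0 d0; set s := tilt * rate delta; have sp := tilt_ge2.
have s0 : 0 < s by rewrite mulr_gt0 ?rate_gt0 //; lra.
have E1 : 1 <= expR (2 * theta + 1) by rewrite -[leLHS]expR0 ler_expR; lra.
move=> hE; split; first by rewrite s0 /=; nra.
have hB : expR (2 * theta + 1) + s^-1 <= 2 / s.
  rewrite ler_pdivlMr // mulrDl mulVf ?gt_eqF //; lra.
have B0 : 0 <= expR (2 * theta + 1) + s^-1 by rewrite addr_ge0 ?expR_ge0 ?invr_ge0 ?ltW.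
have f0 : 0 < 4 ^+ #|~: I| :> R by rewrite exprn_gt0.
have h1 : step_mass I s theta <= (2 / s) ^+ a * 4 ^+ #|~: I|.
  apply: ler_wpM2r; first exact: ltW.
  by apply: lerXn2r; rewrite ?nnegrE // ltW // divr_gt0.
have h2 : delta * (2 / s) ^+ a = (2 / tilt) ^+ a.
  rewrite -{1}(rate_expr d0) -exprMn; congr (_ ^+ _); rewrite /s.
  by field; rewrite !gt_eqF ?rate_gt0 //; lra.
have h3 : (2 / tilt) ^+ a <= 2 / tilt.
  have : 0 <= 2 / tilt <= 1.
    by rewrite divr_ge0 /= ?ler_pdivrMr ?mul1r; lra.
  by case: a card_support_gt0 => // n _ /andP[q0 q1]; rewrite exprS; apply: ler_piMr => //; apply: exprn_ile1.
have e0 := expR_gt0 (1 : R).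
apply: le_trans (_ : expR 1 * 4 ^+ #|~: I| * (2 / tilt) <= _).
  apply: le_trans (_ : expR 1 * 4 ^+ #|~: I| * (delta * (2 / s) ^+ a) <= _).
    have := ler_wpM2l (ltW (mulr_gt0 d0 e0)) h1; nra.
  by rewrite h2 ler_wpM2l // ltW // mulr_gt0.
rewrite /tilt; suff -> : expR 1 * 4 ^+ #|~: I| * (2 / (4 * expR 1 * 4 ^+ #|~: I|)) = 2^-1 :> R by [].
by field; rewrite !gt_eqF.
Qed.

Definition gain_ratio z e : R := gain e z / (gmean z * rate e).

Lemma ratio_ge0 z e : supported I z -> 0 < e <= 1 -> 0 <= gain_ratio z e.
Proof.
move=> hz /andP[e0 e1]; rewrite divr_ge0 ?gain_ge0 ?e1 ?ltW //.
by rewrite mulr_gt0 ?gmean_gt0 ?rate_gt0.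
Qed.

Lemma ratio_bounded z : supported I z -> exists B, 0 <= B /\
  exists2 e0, 0 < e0 & forall e, 0 < e < e0 -> gain_ratio z e <= B.
Proof.
move=> hz; have sp : 0 < tilt by have := tilt_ge2; lra.
exists (tilt * norm1 z / gmean z); split.
  by rewrite ltW // divr_gt0 ?mulr_gt0 ?norm1_gt0 ?gmean_gt0.
pose x : R := (expR 1 * tilt)^-1.
have x0 : 0 < x by rewrite invr_gt0 mulr_gt0 ?expR_gt0.
exists (Num.min 1 (x ^+ a)); first by rewrite lt_min ltr01 exprn_gt0.
move=> e /andP[e0]; rewrite lt_min => /andP[e1 /(rate_lt e0 x0) rx].
have [|s01 rho] := @small_params 0 e (lexx _) e0.
  rewrite mulr0 add0r mulrA -ler_pdivlMl ?mulr_gt0 ?expR_gt0 //.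
  by rewrite mulr1 ltW.
have e01 : 0 <= e <= 1 by rewrite !ltW.
have := gain_upper hz e01 s01 rho; rewrite /gain_ratio => h.
rewrite ler_pdivrMr ?mulr_gt0 ?gmean_gt0 ?rate_gt0 //.
rewrite (_ : _ * (_ * _) = tilt * rate e * norm1 z) //.
by field; rewrite gt_eqF ?gmean_gt0.
Qed.

(** [gain_master] with [k i] just below [lam * z i / w i]. Of the two factors [1 + eta], one is a
    surplus built into [X] and the other pays for rounding [X] up to [lam]. *)
Lemma ratio_compare z w eta : supported I z -> supported I w -> 0 < eta <= 1 ->
  exists2 delta0, 0 < delta0 & forall delta, 0 < delta < delta0 ->
  exists2 e0, 0 < e0 & forall e, 0 < e < e0 ->
    gain_ratio w delta - eta <= (1 + eta) ^+ 2 * gain_ratio z e.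
Proof.
move=> hz hw /andP[eta0 eta1]; have sp := tilt_ge2.
have gz := gmean_gt0 hz; have gw := gmean_gt0 hw; have nw := norm1_gt0 hw.
have sp0 : 0 < tilt by lra.
(* Makes the error [s * norm1 w / theta] of [gain_master] equal to [eta] after normalisation. *)
pose theta := tilt * norm1 w / (gmean w * eta).
have th0 : 0 < theta by rewrite divr_gt0 // mulr_gt0.
pose x : R := (expR (2 * theta + 1) * tilt)^-1.
have x0 : 0 < x by rewrite invr_gt0 mulr_gt0 ?expR_gt0.
exists (Num.min (eta / 4) (x ^+ a)); first by rewrite lt_min divr_gt0 // exprn_gt0.
move=> delta /andP[d0]; rewrite lt_min => /andP[d1 /(rate_lt d0 x0) rx].
have [|s01 rho] := @small_params theta delta (ltW th0) d0.
  by rewrite mulrA -ler_pdivlMl ?mulr_gt0 ?expR_gt0 // mulr1 ltW.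
have p0 := rate_gt0 d0; set p := rate delta in p0 s01 rho rx *.
(* Once [X] exceeds [Bd], rounding is cheap: [eta^-1 <= X] serves [lam], and the other terms give
   [t i >= 4 / eta], which serves [k i]. The threshold [x1] guarantees this for small [e]. *)
pose Bd : R := eta^-1 + \sum_(i in I) 4 * w i / (eta * z i).
have zI i : i \in I -> 0 < z i by move=> iI; have := hz i; rewrite iI.
have wI i : i \in I -> 0 < w i by move=> iI; have := hw i; rewrite iI.
have BdI i : i \in I -> 4 * w i / (eta * z i) <= Bd.
  move=> iI; rewrite /Bd (bigD1 i) //= addrCA lerDl; apply: addr_ge0; first by rewrite invr_ge0 ltW.
  by apply: sumr_ge0 => j /andP[jI _]; rewrite divr_ge0 ?mulr_ge0 ?ltW ?zI ?wI.
have Bde : eta^-1 <= Bd.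
  by rewrite lerDl; apply: sumr_ge0 => j jI; rewrite divr_ge0 ?mulr_ge0 ?ltW ?zI ?wI.
have Bd0 : 0 < Bd by apply: lt_le_trans Bde; rewrite invr_gt0.
pose x1 : R := (1 + eta) * p * gmean w / (gmean z * Bd).
have x10 : 0 < x1 by rewrite divr_gt0 ?mulr_gt0 //; lra.
exists (Num.min 1 (x1 ^+ a)); first by rewrite lt_min ltr01 exprn_gt0.
move=> e /andP[e0]; rewrite lt_min => /andP[e1 /(rate_lt e0 x10) rx1].
have r0 := rate_gt0 e0; set r := rate e in r0 rx1 *.
(* lam ~ X makes prod_i (lam z_i / w_i) * e slightly larger than delta. *)
pose X : R := (1 + eta) * p * gmean w / (gmean z * r).
have XB : Bd <= X.
  rewrite ler_pdivlMr ?mulr_gt0 // mulrCA -ler_pdivlMl // -/r.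
  by move: (ltW rx1); rewrite /x1 ler_pdivlMr ?mulr_gt0 // mulrCA -ler_pdivlMl // mulrA [r * _]mulrC mulrA.
have X0 : 0 < X by apply: lt_le_trans XB.
pose lam := (Num.trunc X).+1.
have lam1 : X < lam%:R by apply: truncnS_gt.
have lam2 : lam%:R <= (1 + eta) * X.
  have : (Num.trunc X)%:R <= X by rewrite truncn_le ltW.
  have : 1 <= eta * X by rewrite -ler_pdivrMl // mulr1 (le_trans Bde).
  rewrite /lam -natr1; lra.
pose t i : R := lam%:R * z i / w i.
pose k i : nat := if i \in I then Num.trunc (t i) else 1%N.
have tI i : i \in I -> 4 / eta <= t i /\ X * (z i / w i) <= t i.
  move=> iI; have z0 := zI i iI; have w0 := wI i iI; split; last first.
    by rewrite /t -mulrA ler_wpM2r ?divr_ge0 ?ltW.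
  have := le_trans (BdI i iI) XB => h; have {}h := le_trans h (ltW lam1).
  rewrite /t ler_pdivlMr // mulrAC ler_pdivrMr //.
  by move: h; rewrite ler_pdivrMr ?mulr_gt0 // mulrA mulrAC.
have kI i : i \in I -> t i * (1 - eta / 4) <= (k i)%:R <= t i.
  move=> iI; have [h1 _] := tI i iI.
  have h4 : 1 <= t i * (eta / 4).
    by move: h1; rewrite ler_pdivrMr //; lra.
  have t0 : 0 <= t i by apply: le_trans h1; rewrite divr_ge0 ?ltW.
  rewrite /k iI truncn_le t0 andbT.
  have := truncnS_gt (t i); rewrite -natr1; lra.
have k0 i : (0 < k i)%N.
  rewrite /k; case: ifP => iI //; rewrite truncn_gt0; have [h1 _] := tI i iI.
  by apply: le_trans h1; rewrite ler_pdivlMr //; lra.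
have k1 i : i \notin I -> k i = 1%N by rewrite /k => /negbTE ->.
have kw i : (k i)%:R * w i <= lam%:R * z i.
  case iI: (i \in I); last first.
    by have := hw i; have := hz i; rewrite iI => -> ->; rewrite !mulr0.
  by have /andP[_] := kI i iI; rewrite /t ler_pdivlMr // wI.
(* The surplus [1 + eta] of [X] absorbs two losses [1 - eta / 4]: truncating [t i] to [k i], and the
   factor [1 - delta]. *)
pose q : R := (1 + eta) * (1 - eta / 4).
have q1 : 1 <= q * (1 - eta / 4) by rewrite /q; nra.
have q0 : 1 <= q by rewrite /q; nra.
have M1 : q ^+ a * delta <= (\prod_i k i)%N%:R * e.
  rewrite -[X in _ * X <= _](rate_expr d0) -[X in _ <= _ * X](rate_expr e0) -/p -/r -exprMn.
  rewrite -ler_pdivrMr ?exprn_gt0 // -expr_div_n.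
  apply: le_trans (_ : \prod_(i in I) (X * (z i / w i) * (1 - eta / 4)) <= _).
    rewrite big_split /= big_split /= !prodr_const prodf_div.
    rewrite -(gmean_expr hz) -(gmean_expr hw) -expr_div_n -!exprMn.
    rewrite le_eqVlt; apply/orP; left; apply/eqP; congr (_ ^+ _).
    by rewrite /X /q; field; rewrite !gt_eqF.
  have -> : (\prod_i k i)%N%:R = \prod_(i in I) (k i)%:R :> R.
    rewrite natr_prod (bigID (mem I)) /= [X in _ * X = _]big1 ?mulr1 //.
    by move=> i /k1 ->.
  apply: ler_prod => i iI; have [_ h2] := tI i iI; have /andP[h3 _] := kI i iI.
  have z0 := zI i iI; have w0 := wI i iI.
  have eta4 : 0 <= 1 - eta / 4 by lra.
  apply/andP; split; last by apply: le_trans h3; rewrite ler_wpM2r.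
  by rewrite mulr_ge0 // ltW // mulr_gt0 // divr_gt0.
have hd : delta <= (\prod_i k i)%N%:R * e * (1 - delta).
  apply: le_trans (_ : q ^+ a * delta * (1 - delta) <= _); last by rewrite ler_wpM2r //; lra.
  have : q <= q ^+ a by case: a card_support_gt0 => // n _; rewrite exprS ler_peMr ?exprn_ege1 //; lra.
  move=> qa; rewrite mulrAC; apply: ler_peMl; first exact: ltW.
  by apply: le_trans q1 _; apply: ler_pM => //; lra.
have e01 : 0 <= e <= 1 by rewrite !ltW.
have d01 : 0 <= delta <= 1 by apply/andP; split; lra.
have lam0 : (0 < lam)%N by [].
have := gain_master I_neq0 hz hw lam0 k0 k1 kw e01 d01 hd s01 th0 rho.
have -> : tilt * p * norm1 w / theta = gmean w * p * eta.
  by rewrite /theta; field; rewrite !gt_eqF.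
have g0 := gain_ge0 e01 z.
move=> h; have {}h : gain delta w - gmean w * p * eta <= (1 + eta) * X * gain e z.
  by apply: le_trans h _; rewrite ler_wpM2r.
rewrite /gain_ratio -/p -/r.
have gp : 0 < gmean w * p by rewrite mulr_gt0.
rewrite -(ler_pM2r gp).
have -> : (gain delta w / (gmean w * p) - eta) * (gmean w * p) = gain delta w - gmean w * p * eta.
  by field; rewrite !gt_eqF.
suff -> : (1 + eta) ^+ 2 * (gain e z / (gmean z * r)) * (gmean w * p) = (1 + eta) * X * gain e z by [].
by rewrite /X; field; rewrite !gt_eqF.
Qed.

(** Boundedness of the ratio turns the factor (1 + h)^2 into an additive error at most 3 h B, to
    which [ratio_compare] adds h. *)
Lemma ratio_le z w eta : supported I z -> supported I w -> 0 < eta ->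
  exists2 delta0, 0 < delta0 & forall delta, 0 < delta < delta0 ->
  exists2 e0, 0 < e0 & forall e, 0 < e < e0 -> gain_ratio w delta <= gain_ratio z e + eta.
Proof.
move=> hz hw eta0; have [B [B0 [e1 e10 hB]]] := ratio_bounded hz.
pose h := Num.min 1 (eta / (1 + 3 * B)).
have h0 : 0 < h by rewrite lt_min ltr01 divr_gt0 //; lra.
have h1 : h <= 1 by rewrite ge_min lexx.
have h2 : h * (1 + 3 * B) <= eta by rewrite -ler_pdivlMr ?ge_min ?lexx ?orbT //; lra.
have [|delta0 d0 hd] := @ratio_compare z w h hz hw; first by rewrite h0.
exists delta0 => // delta /hd[e0 e00 he].
exists (Num.min e0 (Num.min 1 e1)); first by rewrite !lt_min e00 ltr01.
move=> e /andP[ep]; rewrite !lt_min => /and3P[ee0 e_lt1 ee1].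
have := he e; rewrite ep ee0 => /(_ isT).
have := hB e; rewrite ep ee1 => /(_ isT).
have : 0 <= gain_ratio z e by apply: ratio_ge0 => //; rewrite ep ltW.
move: (gain_ratio z e) (gain_ratio w delta) => F G F0 FB.
have : h * F <= h * B by rewrite ler_wpM2l // ltW.
have : h * h * F <= h * B by rewrite -mulrA ler_wpM2l ?(ltW h0) // (le_trans _ FB) // ler_piMl.
rewrite expr2; lra.
Qed.

Lemma gmean_unit : gmean (unit_vec R I) = 1.
Proof.
by apply: big1 => i iI; rewrite /unit_vec iI powR1.
Qed.

(** The integer [m] just above the inverse of [rate e] satisfies 1 < m [rate e] <= 2, so the gain
    1/(2 m) of [gain_unit] is at least a quarter of [rate e]. *)
Lemma ratio_unit_ge e : 0 < e < 1 -> 4^-1 <= gain_ratio (unit_vec R I) e.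
Proof.
move=> /andP[e0 e1]; have r0 := rate_gt0 e0.
have r1 : rate e < 1 by apply: rate_lt; rewrite ?expr1n.
pose m := (Num.trunc (rate e)^-1).+1.
have m1 : (rate e)^-1 < m%:R by apply: truncnS_gt.
have m2 : m%:R <= (rate e)^-1 + 1.
  by rewrite /m -natr1 lerD2r truncn_le invr_ge0 ltW.
have e01 : 0 <= e <= 1 by rewrite !ltW.
have mr : 1 < m%:R * rate e by rewrite -ltr_pdivrMr // mul1r.
have := @gain_unit _ _ _ I_neq0 m e isT e01.
have -> : m%:R ^+ a * e = (m%:R * rate e) ^+ a by rewrite exprMn rate_expr.
have H : 1 <= (m%:R * rate e) ^+ a by apply: exprn_ege1; apply: ltW.
move=> /(_ H) h.
rewrite /gain_ratio gmean_unit mul1r ler_pdivlMr //; apply: le_trans h.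
rewrite -[leRHS]div1r ler_pdivlMr ?mulr_gt0 ?ltr0n //.
have : m%:R * rate e <= 2; last lra.
have : ((rate e)^-1 + 1) * rate e <= 2 by rewrite mulrDl mulVf ?gt_eqF //; lra.
by apply: le_trans; rewrite ler_wpM2r // ltW.
Qed.

(** The supremum of this set is the lower limit at 0+ of the ratio for the unit vector, taken as
    reference. *)
Definition eventual_lower_bounds : set R :=
  [set c | exists2 e0, 0 < e0 & forall e, 0 < e < e0 -> c <= gain_ratio (unit_vec R I) e].

Definition limit_ratio : R := sup eventual_lower_bounds.

Lemma eventual_lower_bounds_has_sup : has_sup eventual_lower_bounds.
Proof.
split; first by exists 4^-1, 1 => //; apply: ratio_unit_ge.
have [B [_ [e0 e00 hB]]] := ratio_bounded (unit_vec_supported R I).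
exists B => c [e1 e10 hc]; pose e := Num.min e0 e1 / 2.
have m0 : 0 < Num.min e0 e1 by rewrite lt_min e00.
have h1 : Num.min e0 e1 <= e0 by rewrite ge_min lexx.
have h2 : Num.min e0 e1 <= e1 by rewrite ge_min lexx orbT.
have ep : 0 < e by rewrite divr_gt0.
by apply: le_trans (hc e _) (hB e _); rewrite ep /=; rewrite /e; lra.
Qed.

Lemma limit_ratio_gt0 : 0 < limit_ratio.
Proof.
apply: lt_le_trans (_ : 4^-1 <= _); first by [].
apply: sup_upper_bound eventual_lower_bounds_has_sup _ _.
by exists 1 => //; apply: ratio_unit_ge.
Qed.

(** For each small [e], [ratio_le] makes [gain_ratio z e - eta] an eventual lower bound of the
    reference ratio, hence at most its lower limit. Conversely, a single [del] where the reference
    ratio exceeds that limit minus [eta / 2] bounds [gain_ratio z e] below for all small [e]. *)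
Lemma ratio_cvg z : supported I z -> gain_ratio z e @[e --> 0^'+] --> limit_ratio.
Proof.
move=> hz; have hu := unit_vec_supported R I.
apply/cvgrPdist_le => eta eta0.
have eta2 : 0 < eta / 2 by rewrite divr_gt0.
have [delta0 d00 hd] := ratio_le hu hz eta0.
have [c [e1 e10 hc] hlt] := sup_adherent eta2 eventual_lower_bounds_has_sup.
have [delta1 d10 hd1] := ratio_le hz hu eta2.
pose del := Num.min e1 delta1 / 2.
have m0 : 0 < Num.min e1 delta1 by rewrite lt_min e10.
have l1 : Num.min e1 delta1 <= e1 by rewrite ge_min lexx.
have l2 : Num.min e1 delta1 <= delta1 by rewrite ge_min lexx orbT.
have dp : 0 < del by rewrite divr_gt0.
have [|e2 e20 he2] := hd1 del; first by rewrite dp /= /del; lra.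
have hcd : c <= gain_ratio (unit_vec R I) del by apply: hc; rewrite dp /= /del; lra.
near=> e.
have ep : 0 < e by near: e; apply: nbhs_right_gt.
have ed0 : e < delta0 by near: e; apply: nbhs_right_lt.
have ee2 : e < e2 by near: e; apply: nbhs_right_lt.
have up : gain_ratio z e - eta <= limit_ratio.
  apply: sup_upper_bound eventual_lower_bounds_has_sup _ _.
  have [|e3 e30 he3] := hd e; first by rewrite ep.
  by exists e3 => // e' he'; rewrite lerBlDr; apply: he3.
have lo := he2 e; rewrite ep ee2 in lo; have {}lo := lo isT.
rewrite ler_norml -/limit_ratio in hlt *; apply/andP; split; lra.
Unshelve. all: by end_near. Qed.

End SmallEpsilon.

(** * Bernoulli site fields on a probability space *)

Section Law.
Variables (R : realType) (d : nat) (dT : measure_display) (Omega : measurableType dT).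
Variables (P : probability Omega R) (e : R) (tau : site d -> Omega -> R).
Hypotheses (e01 : 0 <= e <= 1) (tauP : bernoulli_site_field P e tau).
Variable y : site d.

Definition open_sites (w : Omega) : pred (site d) := fun x => tau x w == 0.

Definition seen N (w : Omega) : {ffun box d N -> bool} :=
  [ffun v => open_sites w (box_site v)].

Let mtau x : measurable_fun setT (tau x). Proof. by have [] := tauP. Qed.

Lemma measurable_tau_preimage x (B : set R) : measurable B -> measurable (tau x @^-1` B).
Proof. by move=> mB; rewrite -[_ @^-1` _]setTI; apply: mtau. Qed.

(** Closed means different from 0 rather than equal to 1, so that the two events partition [Omega]
    everywhere and not only almost surely. *)
Definition value_set (b : bool) : set R := if b then [set 0] else ~` [set 0].

Lemma measurable_value_set b : measurable (value_set b).
Proof. by case: b => /=; [|apply: measurableC]; apply: measurable_set1. Qed.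

Lemma prob_value x b : P (tau x @^-1` value_set b) = (bern e b)%:E.
Proof.
have [_ [_ [t0 _]]] := tauP; case: b => /=; first exact: t0.
rewrite -preimage_setC probability_setC ?t0 //.
by apply: measurable_tau_preimage; apply: measurable_set1.
Qed.

Lemma value_setE x w b : (tau x @^-1` value_set b) w <-> open_sites w x = b.
Proof.
rewrite /open_sites /preimage /=; case: b => /=; first by split => /eqP.
by split => [/eqP/negbTE|/negbT/eqP].
Qed.

Lemma prob_seen N (h : {ffun box d N -> bool}) :
  measurable [set w | seen N w = h] /\
  P [set w | seen N w = h] = (\prod_v bern e (h v))%:E.
Proof.
pose r := [seq box_site v | v <- enum (box d N)].
pose B x := value_set (config (@box_site d N) h x).
have E : [set w | seen N w = h] = \big[setI/setT]_(x <- r) (tau x @^-1` B x).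
  rewrite -bigcap_seq; apply/seteqP; split => w /=.
    move=> sw x /mapP[v _ ->]; apply/value_setE; rewrite -sw; rewrite configE ?ffunE //.
    exact: box_site_inj.
  move=> H; apply/ffunP => v; rewrite ffunE.
  have : (tau (box_site v) @^-1` B (box_site v)) w by apply: H; rewrite /= map_f // mem_enum.
  by move/value_setE => ->; rewrite configE //; apply: box_site_inj.
have ur : uniq r by rewrite map_inj_uniq ?enum_uniq //; apply: box_site_inj.
split.
  rewrite E; apply: bigsetI_measurable => x _.
  by apply: measurable_tau_preimage; apply: measurable_value_set.
have [_ [_ [_ ind]]] := tauP; rewrite E ind // => [|x]; last exact: measurable_value_set.
rewrite big_map big_enum /= -prodEFin; apply: eq_bigr => v _.
by rewrite /B prob_value configE //; apply: box_site_inj.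
Qed.

Definition seen_time N (w : Omega) : R :=
  (ptime (config (@box_site d N) (seen N w)) (origin d) y)%:R.

Lemma seen_time_sum N w : (seen_time N w)%:E =
  (\sum_(h : {ffun box d N -> bool})
     (ptime (config (@box_site d N) h) (origin d) y)%:R%:E * (\1_[set w | seen N w = h] w)%:E)%E.
Proof.
rewrite (bigD1 (seen N w)) //= big1 => [|h hw].
  by rewrite indicE mem_set // mule1 adde0.
by rewrite indicE memNset ?mule0 // => /= /esym/eqP; apply/negP.
Qed.

Lemma measurable_seen_term N (h : {ffun box d N -> bool}) (c : R) :
  measurable_fun setT (fun w => c%:E * (\1_[set w | seen N w = h] w)%:E)%E.
Proof.
have [mh _] := prob_seen h.
by apply: measurable_funeM; apply/measurable_EFinP; apply: measurable_indic.
Qed.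

Lemma measurable_seen_time N : measurable_fun setT (fun w => (seen_time N w)%:E).
Proof.
under eq_fun do rewrite seen_time_sum.
apply: emeasurable_sum => h; exact: measurable_seen_term.
Qed.

Lemma integral_seen_time N : (\int[P]_w (seen_time N w)%:E)%E = (box_time N e y)%:E.
Proof.
under eq_integral do rewrite seen_time_sum.
rewrite ge0_integral_sum //; last by move=> h; apply: measurable_seen_term.
rewrite /box_time /expect -sumEFin; apply: eq_bigr => h _.
have [mh Ph] := prob_seen h.
rewrite ge0_integralZl ?lee_fin //; last first.
  by apply/measurable_EFinP; apply: measurable_indic.
rewrite integral_indic // setIT.
apply: etrans (congr1 (fun p => _ * p)%E Ph) _.
by rewrite -EFinM mulrC.
Qed.

Definition true_time (w : Omega) : R := (ptime (open_sites w) (origin d) y)%:R.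

Lemma true_le_seen N w : true_time w <= seen_time N w.
Proof.
rewrite ler_nat; apply: ptime_mono => x /existsP[v /andP[/eqP <-]].
by rewrite ffunE.
Qed.

(** An optimal walk meets finitely many sites, and a box containing them already yields the true
    time. *)
Lemma seen_time_near w : \forall N \near \oo, seen_time N w = true_time w.
Proof.
have [s [ps ls cs]] := ptimeP (open_sites w) (origin d) y.
pose V := seq_sub (belast (origin d) s).
have [N0 h] := @box_embed d V val val_inj.
near=> N; apply/le_anti; rewrite true_le_seen andbT ler_nat.
have [|j ji jv] := h N; first by near: N; apply: nbhs_infty_ge.
apply: ptime_le; exists s; split => //; apply: leq_trans cs.
rewrite !(eq_in_count (a2 := predC (open_sites w))) // => x xs /=; congr (~~ _).
have -> : x = box_site (j (SeqSub xs)) by rewrite jv.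
by rewrite configE ?ffunE //; apply: box_site_inj.
Unshelve. all: by end_near. Qed.

Lemma seen_time_cvg w : (seen_time N w)%:E @[N --> \oo] --> (true_time w)%:E.
Proof.
apply: cvg_EFin; first exact: nearW.
apply: cvg_near_cst; exact: seen_time_near.
Qed.

Lemma measurable_true_time : measurable_fun setT (fun w => (true_time w)%:E).
Proof.
apply: (@emeasurable_fun_cvg _ _ _ _ (fun N w => (seen_time N w)%:E)) => [N|w _].
  exact: measurable_seen_time.
exact: seen_time_cvg.
Qed.

(** The integral is below every box time by monotonicity, and above their infimum because, by
    dominated convergence, it is their limit. *)
Lemma integral_true_time : (\int[P]_w (true_time w)%:E)%E = (mean_time e y)%:E.
Proof.
pose L : R := (l1 (origin d) y)%:R.
have [|||||itrue _ hlim] := @dominated_convergence _ _ _ P setT measurableT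
   (fun N w => (seen_time N w)%:E) (fun w => (true_time w)%:E) (cst L%:E).
- exact: measurable_seen_time.
- exact: measurable_true_time.
- by apply: aeW => w _; apply: seen_time_cvg.
- exact: finite_measure_integrable_cst.
- by apply: aeW => w N _; rewrite lee_fin ger0_norm // ler_nat ptime_le_l1.
have fin := integrable_fin_num measurableT itrue.
rewrite -(fineK fin); congr (_%:E); apply/le_anti/andP; split.
  apply: mean_time_ge => N; rewrite -lee_fin fineK // -integral_seen_time.
  apply: ge0_le_integral => //.
  - by move=> w _; rewrite lee_fin.
  - exact: measurable_true_time.
  - exact: measurable_seen_time.
  - by move=> w _; rewrite lee_fin true_le_seen.
rewrite -lee_fin fineK //; rewrite -(cvg_lim _ hlim) //.
apply: lime_ge; first by apply/cvg_ex; eexists; exact: hlim.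
by apply: nearW => N; rewrite /= integral_seen_time lee_fin mean_time_le_box.
Qed.

Definition binary (w : Omega) := forall x, tau x w = 0 \/ tau x w = 1.

(** Each site contributes a negligible set; the countable union is indexed through [pickle]. *)
Lemma ae_binary : {ae P, forall w, binary w}.
Proof.
pose bad x := ~` (tau x @^-1` [set 0] `|` tau x @^-1` [set 1]).
have neg x : P.-negligible (bad x).
  have [_ [t1 [t0 _]]] := tauP.
  have m0 : measurable (tau x @^-1` [set 0 : R]) by apply: measurable_tau_preimage; apply: measurable_set1.
  have m1 : measurable (tau x @^-1` [set 1 : R]) by apply: measurable_tau_preimage; apply: measurable_set1.
  have b0 : P (bad x) = 0%E.
    have PU : P (tau x @^-1` [set 0] `|` tau x @^-1` [set 1]) =
        (P (tau x @^-1` [set 0%R]) + P (tau x @^-1` [set 1%R]))%E.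
      apply: measureU => //; apply/seteqP; split => // w [/= -> /eqP].
      by rewrite eq_sym oner_eq0.
    rewrite probability_setC; last exact: measurableU.
    have e1 : e + (1 - e) = 1 by ring.
    by rewrite PU t0 t1 -EFinD e1 subrr.
  by apply/negligibleP => //; apply: measurableC; apply: measurableU.
have := @negligible_bigcup _ _ _ P (fun n => if unpickle n is Some x then bad x else set0).
move=> /(_ _)/negligibleS; apply; last first.
  by move=> n; case: unpickle => [x|]; [apply: neg|apply: negligible_set0].
move=> w /= /existsNP[x hx]; exists (pickle x) => //=; rewrite pickleK.
by move=> [|] /= h; apply: hx; [left|right].
Qed.

Lemma passage_time_binary w : binary w ->
  passage_time (fun v => tau v w) (origin d) y = (true_time w)%:E.
Proof.
move=> hw; have tt s : travel_time (fun v => tau v w) (origin d) s =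
    (count (predC (open_sites w)) (belast (origin d) s))%:R.
  rewrite /travel_time; elim: (belast _ _) => [|v r IH]; first by rewrite big_nil.
  rewrite big_cons IH /= natrD /open_sites; congr (_ + _).
  by have [->|->] := hw v; rewrite ?eqxx ?oner_eq0.
apply/le_anti/andP; split.
  have [s [ps ls cs]] := ptimeP (open_sites w) (origin d) y.
  apply: le_trans (_ : (travel_time (fun v => tau v w) (origin d) s)%:E <= _)%E.
    by apply: ereal_inf_lbound; exists s.
  by rewrite tt lee_fin ler_nat.
apply: le_ereal_inf_tmp => _ [s [ps ls] <-]; rewrite tt lee_fin ler_nat.
by apply: ptime_le; exists s.
Qed.

(** An infimum over the codes of finite paths, other codes being sent to +oo. The identity with
    [true_time] holds only almost everywhere, so measurability is proved directly. *)
Lemma measurable_passage_time :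
  measurable_fun setT (fun w => passage_time (fun v => tau v w) (origin d) y).
Proof.
pose g n w : \bar R := if @unpickle (seq (site d)) n is Some s then
    if `[< paths_from_to (origin d) y s >] then
      (travel_time (fun v => tau v w) (origin d) s)%:E else +oo%E
  else +oo%E.
have -> : (fun w => passage_time (fun v => tau v w) (origin d) y) = (fun w => einfs (g^~ w) 0).
  apply/funext => w; apply/le_anti/andP; split.
    apply: le_ereal_inf_tmp => _ [n _ <-]; rewrite /g; case: unpickle => [s|]; last exact: leey.
    case: asboolP => hs; last exact: leey.
    by apply: ereal_inf_lbound; exists s.
  apply: le_ereal_inf_tmp => _ [s hs <-]; apply: ereal_inf_lbound.
  by exists (pickle s) => //; rewrite /g pickleK asboolT.
apply: measurable_fun_einfs => n; rewrite /g; case: unpickle => [s|] //.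
case: asboolP => _ //; apply/measurable_EFinP.
by apply: measurable_sum => v; apply: mtau.
Qed.

Lemma expected_passage_timeE : expected_passage_time P tau y = (mean_time e y)%:E.
Proof.
rewrite /expected_passage_time -integral_true_time.
apply: ae_eq_integral => //.
- exact: measurable_passage_time.
- exact: measurable_true_time.
by apply: filterS ae_binary => w hw _; apply: passage_time_binary.
Qed.

End Law.

Lemma time_constantE (R : realType) (d : nat) (dT : measure_display)
    (Omega : measurableType dT) (P : probability Omega R) (e : R)
    (tau : site d -> Omega -> R) (z : 'I_d -> R) :
  0 <= e <= 1 -> bernoulli_site_field P e tau -> time_constant P tau z = mu e z.
Proof.
move=> e01 tauP; rewrite /time_constant /mu; congr (limn _); apply/funext => n.
by rewrite (expected_passage_timeE e01 tauP).
Qed.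

(** * Reduction to a standard support *)

Definition first_coords (a b : nat) : {set 'I_(a + b)} := [set i : 'I_(a + b) | (i < a)%N].

Lemma card_first_coords a b : #|first_coords a b| = a.
Proof.
rewrite -[RHS]card_ord -(card_imset _ (@lshift_inj a b)); apply: eq_card => i.
rewrite /first_coords; apply/idP/imsetP => [|[j _ ->]]; rewrite inE; last exact: (ltn_ord j).
by move=> ia; exists (Ordinal ia) => //; apply: val_inj.
Qed.

Lemma sort_coords a b (J : {set 'I_(a + b)}) : #|J| = a ->
  exists p q : 'I_(a + b) -> 'I_(a + b),
    [/\ cancel p q, cancel q p & forall i, (p i \in J) = (i \in first_coords a b)].
Proof.
move=> cJ; pose s := enum J ++ enum (~: J).
have us : uniq s.
  rewrite cat_uniq !enum_uniq /= andbT; apply/hasPn => i.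
  by rewrite !mem_enum inE.
have ms i : i \in s by rewrite mem_cat !mem_enum inE orbN.
have ss : size s = (a + b)%N.
  by rewrite -(card_uniqP us) -[RHS]card_ord; apply: eq_card => i; rewrite ms.
pose p (i : 'I_(a + b)) := nth i s i.
have pi : injective p.
  move=> i j; rewrite /p (set_nth_default j) ?ss // => /eqP.
  by rewrite nth_uniq ?ss // => /eqP /val_inj.
have [q pq qp] := injF_bij pi; exists p, q; split => // i.
rewrite inE /p nth_cat -cardE cJ; case: ltnP => ia.
  by rewrite -mem_enum mem_nth // -cardE cJ.
have : nth i (enum (~: J)) (i - a) \in ~: J.
  rewrite -mem_enum mem_nth // -cardE cardsCs finset.setCK card_ord cJ.
  by have := ltn_ord i; lia.
by rewrite inE => /negbTE.
Qed.

(** The constant may depend on [a] and [b] only, so it is read off one support of size [a] in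
    dimension [a + b]; symmetry transfers it to the others. *)
Definition limit_constant (R : realType) (a b : nat) : R := limit_ratio R (first_coords a b).

Lemma first_coords_neq0 a b : (0 < a)%N -> first_coords a b != finset.set0.
Proof. by move=> a0; rewrite -card_gt0 card_first_coords. Qed.

(** Reflections and a permutation carry [z] to a vector supported on the first [a] coordinates,
    preserving [mu], the norm and the geometric mean. *)
Lemma gain_ratio_cvg (R : realType) (d a b : nat) (z : 'I_d -> R) : d = (a + b)%N ->
  d1 z = a -> (0 < a)%N ->
  (norm1 z - mu e z) / e `^ a%:R^-1 @[e --> 0^'+] --> limit_constant R a b * gamma z.
Proof.
move=> dab; move: z; rewrite {}dab => z za a0.
have [p [q [pq qp pJ]]] := sort_coords za.
pose I := first_coords a b; pose w := (fun i => `|z i|) \o p.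
have I0 : I != finset.set0 by apply: first_coords_neq0.
have cI : #|I| = a by apply: card_first_coords.
have sw : supported I w.
  move=> i; have := pJ i; rewrite -/I /w inE /=.
  by case: (i \in I) => [|/negbFE/eqP ->]; rewrite ?normr_gt0 ?normr0.
have nw : norm1 w = norm1 z.
  rewrite /norm1 [RHS](reindex_inj (can_inj pq)) /=.
  by apply: eq_bigr => i _; rewrite normr_id.
have gw : gmean I w = gamma z.
  rewrite /gmean /gamma [RHS](reindex_inj (can_inj pq)) /= za cI.
  by apply: eq_bigl => i; rewrite pJ.
have H := @cvgMr_tmp R R _ _ _ _ (gamma z) (ratio_cvg I0 sw).
apply: cvg_trans (H _); apply: near_eq_cvg; near=> e.
have e0 : 0 < e by near: e; apply: nbhs_right_gt.
have e1 : e < 1 by near: e; apply: nbhs_right_lt.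
have e01 : 0 <= e <= 1 by rewrite !ltW.
have -> : mu e z = mu e w by rewrite /w (mu_reindex e01 _ pq qp) mu_abs.
have g0 := gmean_gt0 sw; rewrite gw in g0.
rewrite /gain_ratio /gain nw gw /rate cI.
by field; rewrite !gt_eqF ?powR_gt0.
Unshelve. all: by end_near. Qed.

Theorem theorem2 (R : realType) :
  exists C : nat -> nat -> R,
    (forall a b : nat, (1 <= a)%N -> 0 < C a b) /\
    forall d : nat, (2 <= d)%N ->
    forall (dT : measure_display) (Omega : measurableType dT)
           (P : R -> probability Omega R) (tau : R -> site d -> Omega -> R),
      (forall eps : R, 0 <= eps <= 1 -> bernoulli_site_field (P eps) eps (tau eps)) ->
    forall z : 'I_d -> R, (exists i, z i != 0) ->
      (fun eps : R =>
         (time_constant (P eps) (tau eps) z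
            - (norm1 z - C (d1 z) (d2 z) * gamma z * eps `^ (d1 z)%:R^-1))
         / eps `^ (d1 z)%:R^-1) @ 0^'+ --> 0.
Proof.
exists (limit_constant R); split=> [a b a0|d _ dT Omega P tau tauP z [i zi]].
  exact/limit_ratio_gt0/first_coords_neq0.
have z0 : (0 < d1 z)%N by rewrite card_gt0; apply/set0Pn; exists i; rewrite inE.
have dE : d = (d1 z + d2 z)%N.
  by rewrite subnKC // -[leqRHS](card_ord d) max_card.
have H := gain_ratio_cvg dE erefl z0.
set c := limit_constant R (d1 z) (d2 z) * gamma z in H *.
(* The quotient of the statement is the constant term minus the normalised gain. *)
have {}H : (fun e => c - (norm1 z - mu e z) / e `^ (d1 z)%:R^-1) @ 0^'+ --> c - c.
  by apply: cvgB H; apply: cvg_cst.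
rewrite subrr in H; apply: cvg_trans H; apply: near_eq_cvg; near=> e.
have e0 : 0 < e by near: e; apply: nbhs_right_gt.
have e1 : e < 1 by near: e; apply: nbhs_right_lt.
have e01 : 0 <= e <= 1 by rewrite !ltW.
rewrite (time_constantE z e01 (tauP e e01)).
by field; rewrite gt_eqF ?powR_gt0.
Unshelve. all: by end_near. Qed.
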